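(* Let $\mathcal{P}_1:(\mathbb{W}^+)'\to\mathbb{W}^+$ be a symmetric and positive definite operator, let $\mathbb{W}_N^+\subset\mathbb{W}^+$ be a closed subspace, and assume that the eigenvalues $\lambda$ of the generalized eigenvalue problem $$(\mathcal{E}-\mathcal{K})w=\lambda\,\mathcal{P}_1^{-1}w$$ satisfy $\beta\le\lambda\le 1$ for some $0<\beta\le 1$. Let $u^+\in\mathbb{W}^+$ be the solution of $(\mathcal{E}-\mathcal{K})u^+=\ell$. Then, for any $u_0^+\in\mathbb{W}^+$, the sequence $\{u_n^+\}$ defined by $$u^+_{n+\frac12}=u^+_n-\mathcal{P}_1\big((\mathcal{E}-\mathcal{K})u^+_n-\ell\big),\qquad u^+_{n+1}=u^+_{n+\frac12}+u^+_{c,n},$$ where $u^+_{c,n}\in\mathbb{W}_N^+$ is the solution of $$\langle(\mathcal{E}-\mathcal{K})u^+_{c,n},v\rangle=\big\langle\big((\mathcal{E}-\mathcal{K})\mathcal{P}_1-\mathcal{I}\big)\big((\mathcal{E}-\mathcal{K})u^+_n-\ell\big),v\big\rangle\quad\text{for all }v\in\mathbb{W}_N^+,$$ converges linearly to $u^+$, i.e., $$\|u^+-u^+_{n+1}\|_{\mathcal{E}-\mathcal{K}}\le(1-\beta)\,\|u^+-u^+_n\|_{\mathcal{E}-\mathcal{K}} .$$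
   Context: Let $R\subset\mathbb{R}^d$ ($d\le 3$) be a bounded convex domain with outer unit normal $n(r)$ on $\partial R$, $S\subset\mathbb{R}^3$ the unit sphere, $D=S\times R$, $\partial D:=S\times\partial R$, and $\partial D_-=\{(s,r)\in S\times\partial R: s\cdot n(r)<0\}$; here $s\cdot\nabla_r=\sum_{i=1}^d s_i\partial_{r_i}$ and $s\cdot n=\sum_{i=1}^d s_in_i$. Let $\mathbb{V}=L^2(D)$ with inner product $(\cdot,\cdot)$, and let $L^2(\partial D_-;|s\cdot n|)$ be the space of measurable $w$ with $|s\cdot n|^{1/2}w\in L^2(\partial D_-)$. Set $$\mathbb{W}=\{w\in L^2(D): s\cdot\nabla_r w\in L^2(D),\ w|_{\partial D_-}\in L^2(\partial D_-;|s\cdot n|)\}$$ with $\|w\|_{\mathbb{W}}^2=\|s\cdot\nabla_rw\|_{L^2(D)}^2+\|w\|_{L^2(D)}^2+\|w\|_{L^2(\partial D_-;|s\cdot n|)}^2$. $\mathbb{V}^\pm$ denotes the subspaces of even/odd functions of $s$ (i.e. $v(-s,r)=\pm v(s,r)$), and $\mathbb{W}^\pm=\mathbb{W}\cap\mathbb{V}^\pm$. $\langle\cdot,\cdot\rangle$ is the duality pairing of $(\mathbb{W}^+)'$ and $\mathbb{W}^+$, and $\mathbb{V}$ is identified with its dual. $\mathcal{I}$ is the identity. Constants and coefficients: $0\le g<1$; $\sigma_a,\sigma_s\in L^\infty(R)$ non-negative with $\sigma_a\ge\gamma>0$ a.e. for some constant $\gamma$; $\sigma_t=\sigma_a+\sigma_s$.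 Operators: $(\mathcal{S}u)(s)=\int_S k(s\cdot s')u(s')\,ds'$ with $k(s\cdot s')=\frac{1}{4\pi}\frac{1-g^2}{[1-2g(s\cdot s')+g^2]^{3/2}}$ (acting in $s$ only); $\mathcal{K}u=\sigma_s\mathcal{S}u$; $\mathcal{M}u=\sigma_tu$ (both map even to even and odd to odd functions, and $\mathcal{M}-\mathcal{K}$ is boundedly invertible on $\mathbb{V}^-$); $\mathcal{A}:\mathbb{W}^+\to\mathbb{V}^-$, $\mathcal{A}u^+=s\cdot\nabla_ru^+$; $\mathcal{A}':\mathbb{V}^-\to(\mathbb{W}^+)'$, $\langle\mathcal{A}'u^-,w^+\rangle=(\mathcal{A}w^+,u^-)$; $\mathcal{R}:\mathbb{W}^+\to(\mathbb{W}^+)'$, $\langle\mathcal{R}u^+,w^+\rangle=\int_{\partial D}|s\cdot n|u^+w^+$; and $$\mathcal{E}:\mathbb{W}^+\to(\mathbb{W}^+)',\qquad \mathcal{E}u^+=\mathcal{R}u^++\mathcal{A}'(\mathcal{M}-\mathcal{K})^{-1}\mathcal{A}u^++\mathcal{M}u^+ .$$ The problem $(\mathcal{E}-\mathcal{K})u^+=\ell$ is symmetric and coercive on $\mathbb{W}^+$ and well-posed by the Lax-Milgram lemma; $\|w\|_{\mathcal{E}-\mathcal{K}}^2=\langle(\mathcal{E}-\mathcal{K})w,w\rangle$. For given $q\in L^2(D)$ and boundary data $f\in L^2(\partial D_-;|s\cdot n|)$, the functional $\ell\in(\mathbb{W}^+)'$ is $\ell(w^+)=(q,w^+)+2\int_{\partial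 D_-}|s\cdot n|f w^++((\mathcal{M}-\mathcal{K})^{-1}q,\mathcal{A}w^+)$.
   Formalization: The bound β ≤ λ ≤ 1 is assumed for all spectral values of (E−K)w = λP₁⁻¹w, not only for eigenvalues; with eigenvalues alone the claim fails, e.g. W_N⁺ = {0} and P₁(E−K) with purely continuous spectrum [0,10]. *)

(* Defs.v *)
From HB Require Import structures.
From mathcomp Require Import all_boot all_order all_algebra.
From mathcomp Require Import all_classical all_reals all_analysis.
From mathcomp Require Import measurable_realfun.
Set Implicit Arguments.
Unset Strict Implicit.
Unset Printing Implicit Defensive.
Import Order.TTheory GRing.Theory Num.Theory.
Import numFieldNormedType.Exports.
Local Open Scope classical_set_scope.
Local Open Scope ring_scope.

Fact rV_display : measure_display. Proof. exact: default_measure_display. Qed.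

(* The sigma-algebra generated by the coordinates, i.e. the Borel one. *)
Section measurable_rV.
Variables (R : realType) (n : nat).

Definition rV_coord (i : 'I_n) (x : 'rV[R]_n) : measurableTypeR R := x 0 i.

HB.instance Definition _ := @isMeasurable.Build rV_display 'rV[R]_n
  (g_sigma_preimage rV_coord) (@sigma_algebra0 _ _ _) (@sigma_algebraC _ _)
  (@sigma_algebra_bigcup _ _ _).

Lemma measurable_rV_coord (i : 'I_n) : measurable_fun setT (rV_coord i).
Proof.
move=> _ Y mY; rewrite setTI; apply: sub_sigma_algebra => /=.
rewrite -bigcup_seq/=; exists i => /=; first by rewrite mem_index_enum.
by exists Y => //; rewrite setTI.
Qed.

Lemma measurable_fun_rVP d (T : measurableType d) (f : T -> 'rV[R]_n) :
  measurable_fun setT f <->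
  forall i, measurable_fun setT (rV_coord i \o f).
Proof.
split=> [mf i|mf].
  by apply: measurableT_comp => //; exact: measurable_rV_coord.
move=> _ Y; rewrite setTI.
rewrite /measurable/= => mY.
suff : (preimage_set_system setT f (g_sigma_preimage rV_coord)) (f @^-1` Y).
  rewrite -g_sigma_preimage_comp.
  apply: smallest_sub; first exact: sigma_algebra_measurable.
  move=> A; rewrite -bigcup_seq/= => -[i _ [B mB <-]].
  exact: mf.
by exists Y => //; rewrite setTI.
Qed.
Lemma open_measurable_rV (A : set 'rV[R]_n) : open A -> measurable A.
Proof.
move=> oA.
pose q (v : 'rV[rat]_n) : 'rV[R]_n := map_mx ratr v.
pose box (p : 'rV[rat]_n * nat) : set 'rV[R]_n :=
  [set x | forall i, `|x 0 i - q p.1 0 i| < p.2.+1%:R^-1].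
pose I := [set p | box p `<=` A].
have -> : A = \bigcup_(p in I) box p.
  apply/seteqP; split=> [x Ax|x [p Ip]]; last exact: Ip.
  have /nbhs_ballP[e /= e0 eA] := open_nbhs_nbhs (conj oA Ax).
  have e20 : 0 < e / 2 by rewrite divr_gt0.
  have [k _ /(_ k (leqnn k)) /= ke] := near_infty_natSinv_lt (PosNum e20).
  have ki : (0 : R) < k.+1%:R^-1 by rewrite invr_gt0.
  have hq i : exists r : rat, `|x 0 i - ratr r| < k.+1%:R^-1.
    have : x 0 i - k.+1%:R^-1 < x 0 i + k.+1%:R^-1.
      by rewrite ltrBlDr -addrA ltrDl addr_gt0.
    move=> /rat_in_itvoo[r]; rewrite in_itv/= => /andP[r1 r2].
    by exists r; rewrite distrC ltr_distl r1 r2.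
  pose r i := xget 0 [set r : rat | `|x 0 i - ratr r| < k.+1%:R^-1].
  have xr i : `|x 0 i - ratr (r i)| < k.+1%:R^-1 by exact: (xgetPex 0 (hq i)).
  exists (\row_i r i, k); last by move=> i /=; rewrite !mxE.
  move=> y /= yb; apply: eA; split=> // i0 i; rewrite ord1.
  have := yb i; rewrite /= !mxE /ball/= => yr.
  rewrite -(subrKA (ratr (r i))) (le_lt_trans (ler_normD _ _))//.
  rewrite [e]splitr ltrD//; first exact: (lt_trans (xr i) ke).
  by rewrite distrC; exact: (lt_trans yr ke).
rewrite bigcup_mkcond; apply: countable_bigcupT_measurable => // p.
case: ifPn => // _.
have -> : box p = \bigcap_i (rV_coord i @^-1` [set y | `|y - q p.1 0 i| < p.2.+1%:R^-1]).
  by apply/seteqP; split => x; [move=> h i _; exact: h|move=> h i; exact: h].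
apply: fin_bigcap_measurable => // i _.
rewrite -[X in measurable X]setTI; apply: measurable_rV_coord => //.
have -> : [set y : R | `|y - q p.1 0 i| < p.2.+1%:R^-1] =
    `]q p.1 0 i - p.2.+1%:R^-1, q p.1 0 i + p.2.+1%:R^-1[%classic.
  by apply/seteqP; split => y /=; rewrite in_itv/= ltr_distl.
exact: measurable_itv.
Qed.
End measurable_rV.

Lemma measurable_rV_box (R : realType) n (a b : R) :
  measurable [set x : 'rV[R]_n | forall i, x 0 i \in `[a, b]].
Proof.
rewrite [X in measurable X](_ : _ = \bigcap_i (rV_coord i @^-1` [set` `[a, b]])).
  apply: fin_bigcap_measurable => // i _.
  rewrite -[X in measurable X]setTI.
  by apply: measurable_rV_coord => //; exact: measurable_itv.
by apply/seteqP; split => x; [move=> h i _; exact: h|move=> h i; exact: h].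
Qed.

Section lebesgue_rV.
Variable R : realType.

Definition rV_cons n (p : R * 'rV[R]_n) : 'rV[R]_n.+1 :=
  \row_i oapp (p.2 0) p.1 (unlift ord0 i).

Lemma measurable_rV_cons n :
  measurable_fun [set: (measurableTypeR R * 'rV[R]_n)%type] (@rV_cons n).
Proof.
apply/measurable_fun_rVP => i.
case: (unliftP ord0 i) => [j ->|->].
  rewrite [X in measurable_fun _ X](_ : _ = rV_coord j \o snd).
    by apply: measurableT_comp => //; exact: measurable_rV_coord.
  by apply/funext => p; rewrite /= /rV_coord /= mxE liftK.
rewrite [X in measurable_fun _ X](_ : _ = fst)//.
by apply/funext => p; rewrite /= /rV_coord /= mxE unlift_none.
Qed.

Section step.
Variables (n : nat) (mu : {sigma_finite_measure set 'rV[R]_n -> \bar R}).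

Definition lebesgue_rVS : set 'rV[R]_n.+1 -> \bar R :=
  pushforward (@lebesgue_measure R \x mu)%E (@rV_cons n).



Local Notation mpush :=
  (measure_function_pushforward__canonical__measure_function_Measure
     (@lebesgue_measure R \x mu)%E (@measurable_rV_cons n)).

HB.instance Definition _ := isMeasure.Build _ _ _ lebesgue_rVS
  (measure0 mpush) (measure_ge0 mpush) (@measure_semi_sigma_additive _ _ _ mpush).

Definition rV_uncons (x : 'rV[R]_n.+1) : measurableTypeR R * 'rV[R]_n :=
  (x 0 ord0, \row_j x 0 (lift ord0 j)).

Lemma rV_consK : cancel (@rV_cons n) rV_uncons.
Proof.
move=> [x y]; rewrite /rV_uncons mxE unlift_none/=; congr pair.
by apply/rowP => j; rewrite !mxE liftK.
Qed.

Lemma measurable_rV_uncons : measurable_fun setT rV_uncons.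
Proof.
apply/measurable_fun_pairP; split; first exact: measurable_rV_coord.
apply/measurable_fun_rVP => j.
rewrite [X in measurable_fun _ X](_ : _ = rV_coord (lift ord0 j)).
  exact: measurable_rV_coord.
by apply/funext => x; rewrite /= /rV_coord mxE.
Qed.

Let lebesgue_rVS_sigma_finite : sigma_finite setT lebesgue_rVS.
Proof.
have /sigma_finiteP[F [TF ndF Foo]] := sigma_finiteT (@lebesgue_measure R).
have /sigma_finiteP[G [TG ndG Goo]] := sigma_finiteT mu.
exists (fun k => rV_uncons @^-1` (F k `*` G k)).
  rewrite -preimage_bigcup predeqE => x; split=> // _.
  have [k _ Fk] : (\bigcup_k F k) (rV_uncons x).1 by rewrite -TF.
  have [m _ Gm] : (\bigcup_k G k) (rV_uncons x).2 by rewrite -TG.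
  exists (maxn k m) => //; split.
    by move: Fk; exact/subsetPset/ndF/leq_maxl.
  by move: Gm; exact/subsetPset/ndG/leq_maxr.
move=> k; have [? ?] := Foo k; have [? ?] := Goo k; split.
  rewrite -[X in measurable X]setTI.
  by apply: measurable_rV_uncons => //; exact: measurableX.
rewrite /lebesgue_rVS /pushforward -comp_preimage.
rewrite (_ : _ \o _ = id); last by apply/funext => p; exact: rV_consK.
by rewrite preimage_id product_measure1E// lte_mul_pinfty// ge0_fin_numE.
Qed.

HB.instance Definition _ :=
  Measure_isSigmaFinite.Build _ _ _ lebesgue_rVS lebesgue_rVS_sigma_finite.

End step.

Fixpoint lebesgue_rV n : {sigma_finite_measure set 'rV[R]_n -> \bar R} :=
  if n is m.+1 then lebesgue_rVS (lebesgue_rV m) else \d_(0 : 'rV[R]_0).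

Lemma lebesgue_rV_box n (a b : R) :
  lebesgue_rV n [set x | forall i, x 0 i \in `[a, b]] =
  (lebesgue_measure [set` `[a, b]] ^+ n)%E.
Proof.
elim: n => [|n IH].
  rewrite /= diracE mem_set//= => -[]//.
pose B : set 'rV[R]_n := [set x | forall i, x 0 i \in `[a, b]].
have mB : measurable B by exact: measurable_rV_box.
transitivity ((@lebesgue_measure R \x lebesgue_rV n)%E ([set` `[a, b]] `*` B)).
  congr ((_ \x _)%E _); apply/seteqP; split => -[x y] /=.
    move=> h; split; first by have := h ord0; rewrite mxE unlift_none.
    move=> i /=; have := h (lift ord0 i).
    by rewrite [X in X \in _ -> _]mxE liftK.
  move=> [hx hy] i; rewrite mxE; case: (unliftP ord0 i) => [j _|_] /=.
    exact: hy.
  exact: hx.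
by rewrite product_measure1E// IH expeS.
Qed.

End lebesgue_rV.

(* Outer measure obtained from the weight w by countable covers with sets in P. *)
Section cover_outer_measure.
Local Open Scope ereal_scope.
Variables (R : realType) (T : Type) (P : set (set T)) (w : set T -> \bar R).
Hypothesis w_ge0 : forall U, 0 <= w U.
Hypotheses (P0 : P set0) (w0 : w set0 = 0).

Definition cover_by (A : set T) : set (set T)^nat :=
  [set U | (forall k, P (U k)) /\ A `<=` \bigcup_k U k].

Definition cover_outer (A : set T) : \bar R :=
  ereal_inf [set \sum_(k <oo) w (U k) | U in cover_by A].

Lemma cover_outer_ge0 A : 0 <= cover_outer A.
Proof.
by apply: le_ereal_inf_tmp => x [B _ <-{x}]; exact: nneseries_ge0.
Qed.

Lemma cover_outer0 : cover_outer set0 = 0.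
Proof.
apply/eqP; rewrite eq_le; apply/andP; split; last exact/cover_outer_ge0.
apply: ereal_inf_lbound; exists (fun=> set0); first by split.
by apply: eseries0 => k _ _.
Qed.

Lemma cover_outer_sigma_subadditive : sigma_subadditive cover_outer.
Proof.
move=> A; have [[i ioo]|] := pselect (exists i, cover_outer (A i) = +oo).
  rewrite (eseries_pinfty _ _ ioo) ?leey// => n _.
  by rewrite -ltNye (lt_le_trans _ (cover_outer_ge0 _)).
rewrite -forallNE => Aoo.
suff add2e (e : {posnum R}) :
    cover_outer (\bigcup_n A n) <= \sum_(i <oo) cover_outer (A i) + e%:num%:E.
  by apply/lee_addgt0Pr => _/posnumP[].
rewrite (le_trans _ (epsilon_trick _ _ _))//; last first.
  by move=> n; exact: cover_outer_ge0.
pose Q n (B : (set T)^nat) := cover_by (A n) B /\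
  \sum_(k <oo) w (B k) <= cover_outer (A n) + (e%:num / (2 ^ n.+1)%:R)%:E.
have [G PG] : {G : ((set T)^nat)^nat & forall n, Q n (G n)}.
  apply: (@choice _ _ Q) => n; rewrite /Q /cover_outer.
  set S := (X in ereal_inf X); move infS : (ereal_inf S) => iS.
  case: iS infS => [r Sr|Soo|Soo].
  - have en1 : (0 < e%:num / (2 ^ n.+1)%:R)%R by [].
    have /(lb_ereal_inf_adherent en1) : ereal_inf S \is a fin_num by rewrite Sr.
    move=> [x [B [mB AnB] muBx] xS].
    by exists B; split => //; rewrite muBx -Sr; exact/ltW.
  - by have := Aoo n; rewrite /cover_outer Soo.
  - suff : lbound S 0 by move/le_ereal_inf_tmp; rewrite Soo.
    by move=> /= _ [B [mB AnB] <-]; exact: nneseries_ge0.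
have muG_ge0 x : 0 <= (w \o uncurry G) x by exact: w_ge0.
apply: (@le_trans _ _ (\esum_(i in setT) (w \o uncurry G) i)).
  apply: ereal_inf_lbound => /=.
  have /card_esym/ppcard_eqP[f] := card_nat2.
  exists (uncurry G \o f).
    split => [i|]; first by rewrite /= /uncurry; case: (f i) => a b; exact: (PG a).1.1.
    apply: (@subset_trans _  (\bigcup_n \bigcup_k G n k)) => [t [i _]|].
      by move=> /((PG i).1.2) -[j _ ?]; exists i => //; exists j.
    move=> t [i _ [j _ Bijt]]; exists (f^-1%FUN (i, j)) => //=.
    by rewrite invK ?inE.
  rewrite -(esum_pred_image (w \o uncurry G) _ xpredT) ?[fun=> _]set_true//.
  by rewrite image_eq.
rewrite (_ : esum _ _ = \sum_(i <oo) \sum_(j <oo ) w (G i j)); last first.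
  pose J : nat -> set (nat * nat) := fun i => [set (i, j) | j in setT].
  rewrite (_ : setT = \bigcup_k J k); last first.
    by rewrite predeqE => -[a b]; split => // _; exists a => //; exists b.
  rewrite esum_bigcupT /=; last 2 first.
    - apply/trivIsetP => i j _ _ ij.
      rewrite predeqE => -[n m] /=; split => //= -[] [_] _ [<-{n} _].
      by move=> [m' _] [] /esym/eqP; rewrite (negbTE ij).
    - by move=> /= [n m]; exact: w_ge0.
  rewrite -(image_id [set: nat]) -fun_true esum_pred_image//; last first.
    by move=> n _; exact: esum_ge0.
  apply: eq_eseriesr => /= j _.
  rewrite -(esum_pred_image (w \o uncurry G) (pair j) predT)//=; last first.
    by move=> ? ? _ _; exact: (@can_inj _ _ _ snd).
  by congr esum; rewrite predeqE => -[a b]; split; move=> [i _ <-]; exists i.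
apply: lee_lim.
- apply: is_cvg_nneseries => n *.
  by apply: nneseries_ge0 => m *; exact: (muG_ge0 (n, m)).
- by apply: is_cvg_nneseries => n *; apply: adde_ge0 => //; exact: cover_outer_ge0.
- by near=> n; apply: lee_sum => i _; exact: (PG i).2.
Unshelve. all: by end_near. Qed.

Lemma le_cover_outer : {homo cover_outer : A B / A `<=` B >-> A <= B}.
Proof.
move=> A B AB; apply/ereal_inf_le_tmp => x [U [PU BU] <-{x}].
by exists U => //; split => //; apply: subset_trans AB BU.
Qed.

End cover_outer_measure.

Section euclidean.
Variables (R : realType) (n : nat).
Implicit Types x y : 'rV[R]_n.

Definition dotr x y : R := \sum_(i < n) x 0 i * y 0 i.
Definition enorm x : R := Num.sqrt (dotr x x).

Definition ediam (U : set 'rV[R]_n) : \bar R :=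
  ereal_sup [set (enorm (x - y))%:E | x in U & y in U].

End euclidean.

(* Volume of the unit ball of R^m; it normalizes the m-dimensional Hausdorff
   measure so that it agrees with the m-dimensional Euclidean volume. *)
Fixpoint ball_volume (R : realType) (m : nat) : R :=
  match m with
  | 0 => 1
  | 1 => 2
  | k.+2 => 2 * pi / k.+2%:R * ball_volume R k
  end.

Section hausdorff.
Local Open Scope ereal_scope.
Variables (R : realType) (n m : nat).

Definition hausdorff_weight (U : set 'rV[R]_n) : \bar R :=
  if U == set0 then 0 else (ball_volume R m / 2 ^+ m)%:E * ediam U ^+ m.

Definition hausdorff_pre (delta : R) : set 'rV[R]_n -> \bar R :=
  cover_outer [set U | ediam U <= delta%:E] hausdorff_weight.

Definition hausdorff (A : set 'rV[R]_n) : \bar R :=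
  ereal_sup [set hausdorff_pre delta A | delta in [set e : R | (0 < e)%R]].

Lemma ball_volume_ge0 k : (0 <= ball_volume R k)%R.
Proof.
suff : (0 <= ball_volume R k)%R && (0 <= ball_volume R k.+1)%R by case/andP.
elim: k => [|k /andP[h1 h2]]; first by rewrite /= ler01 ler0n.
by rewrite h2 /= mulr_ge0// divr_ge0// mulr_ge0// pi_ge0.
Qed.

Lemma ediam_ge0 (U : set 'rV[R]_n) : U !=set0 -> 0 <= ediam U.
Proof.
move=> [x Ux]; apply: (@le_trans _ _ (enorm (x - x))%:E).
  by rewrite lee_fin sqrtr_ge0.
by apply: ereal_sup_ubound; exists x => //; exists x.
Qed.

Lemma hausdorff_weight_ge0 U : 0 <= hausdorff_weight U.
Proof.
rewrite /hausdorff_weight; case: eqVneq => // /set0P U0.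
apply: mule_ge0.
  by rewrite lee_fin divr_ge0 ?ball_volume_ge0// exprn_ge0.
by rewrite expe_ge0// ediam_ge0.
Qed.

Lemma hausdorff_weight0 : hausdorff_weight set0 = 0.
Proof. by rewrite /hausdorff_weight eqxx. Qed.

Lemma ediam0 (delta : R) : @ediam R n set0 <= delta%:E.
Proof.
by apply: ge_ereal_sup => x [? []].
Qed.

Lemma hausdorff0 : hausdorff set0 = 0.
Proof.
apply/eqP; rewrite eq_le; apply/andP; split.
  apply: ge_ereal_sup => _ [e e0 <-]; rewrite /hausdorff_pre cover_outer0//.
  - exact: hausdorff_weight_ge0.
  - exact: ediam0.
  - exact: hausdorff_weight0.
apply: (@le_trans _ _ (hausdorff_pre 1 set0)).
  exact/cover_outer_ge0/hausdorff_weight_ge0.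
by apply: ereal_sup_ubound; exists 1%R => //=.
Qed.

Lemma hausdorff_ge0 A : 0 <= hausdorff A.
Proof.
apply: (@le_trans _ _ (hausdorff_pre 1 A)).
  exact/cover_outer_ge0/hausdorff_weight_ge0.
by apply: ereal_sup_ubound; exists 1%R => //=.
Qed.

Lemma le_hausdorff : {homo hausdorff : A B / A `<=` B >-> A <= B}.
Proof.
move=> A B AB; apply: ge_ereal_sup => _ [e e0 <-].
apply: (@le_trans _ _ (hausdorff_pre e B)); first exact: le_cover_outer.
by apply: ereal_sup_ubound; exists e.
Qed.

Lemma hausdorff_sigma_subadditive : sigma_subadditive hausdorff.
Proof.
move=> F; apply: ge_ereal_sup => _ [e e0 <-].
apply: (@le_trans _ _ (\sum_(i <oo) hausdorff_pre e (F i))).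
  apply: cover_outer_sigma_subadditive; first exact: hausdorff_weight_ge0.
apply: lee_nneseries => [i _ _|i _].
  exact/cover_outer_ge0/hausdorff_weight_ge0.
by apply: ereal_sup_ubound; exists e.
Qed.

HB.instance Definition _ := isOuterMeasure.Build R 'rV[R]_n hausdorff
  hausdorff0 hausdorff_ge0 le_hausdorff hausdorff_sigma_subadditive.

End hausdorff.

Section restr_outer.
Local Open Scope ereal_scope.
Variables (R : realType) (T : Type) (mu : {outer_measure set T -> \bar R}).
Variable D : set T.

Definition restr_outer (A : set T) : \bar R := mu (A `&` D).

Let restr_outer0 : restr_outer set0 = 0.
Proof. by rewrite /restr_outer set0I outer_measure0. Qed.

Let restr_outer_ge0 A : 0 <= restr_outer A.
Proof. exact: outer_measure_ge0. Qed.

Let le_restr_outer : {homo restr_outer : A B / A `<=` B >-> A <= B}.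
Proof. by move=> A B AB; apply: le_outer_measure; exact: setSI. Qed.

Let restr_outer_sigma_subadditive : sigma_subadditive restr_outer.
Proof.
by move=> F; rewrite /restr_outer setI_bigcupl; exact: outer_measure_sigma_subadditive.
Qed.

HB.instance Definition _ := isOuterMeasure.Build R T restr_outer
  restr_outer0 restr_outer_ge0 le_restr_outer restr_outer_sigma_subadditive.

End restr_outer.

Section lebesgue_bounded.
Variables (R : realType) (n : nat).

Lemma lebesgue_rV_bounded (A : set 'rV[R]_n) :
  measurable A -> bounded_set A -> (lebesgue_rV R n A < +oo)%E.
Proof.
move=> mA [M [_ hM]].
pose K := `|M| + 1; pose B : set 'rV[R]_n := [set x | forall i, x 0 i \in `[- K, K]].
have AB : A `<=` B.
  move=> x Ax i; rewrite in_itv/= -ler_norml.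
  apply: le_trans (hM K _ x Ax); last by rewrite (le_lt_trans (ler_norm M))// ltrDl.
  rewrite /= {2}/Num.norm/= mx_normrE.
  by apply/bigmax_geP; right; exists (0, i).
have mB : measurable B by exact: measurable_rV_box.
apply: (@le_lt_trans _ _ (lebesgue_rV R n B)).
  by apply: le_measure => //; rewrite inE.
rewrite (lebesgue_rV_box n (- K) K) lebesgue_measure_itv/=.
by case: ifPn => _; rewrite -?EFinD -?EFin_expe ltry.
Qed.

End lebesgue_bounded.

Section sphere.
Variables (R : realType) (n : nat).

Definition punctured_ball : set 'rV[R]_n := [set x | 0 < enorm x <= 1].
Definition normalize (x : 'rV[R]_n) : 'rV[R]_n := (enorm x)^-1 *: x.

Lemma dotr_ge0 (x : 'rV[R]_n) : 0 <= dotr x x.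
Proof. by apply: sumr_ge0 => i _; rewrite -expr2 sqr_ge0. Qed.

Lemma measurable_enorm : measurable_fun setT (@enorm R n).
Proof.
rewrite (_ : enorm (n := n) = fun x => dotr x x `^ 2^-1); last first.
  by apply/funext => x; rewrite powR12_sqrt// dotr_ge0.
apply: (measurableT_comp (measurable_powR _)).
apply: measurable_sum => i.
by apply: measurable_funM; exact: measurable_rV_coord.
Qed.

Lemma measurable_normalize : measurable_fun setT normalize.
Proof.
apply/measurable_fun_rVP => i.
rewrite (_ : _ \o _ = fun x => enorm x `^ (- 1) * x 0 i); last first.
  apply/funext => x; rewrite /= /rV_coord /normalize mxE powRN powRr1//.
  exact: sqrtr_ge0.
apply: measurable_funM; last exact: measurable_rV_coord.
exact: (measurableT_comp (measurable_powR _) measurable_enorm).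
Qed.

Lemma measurable_punctured_ball : measurable punctured_ball.
Proof.
rewrite (_ : punctured_ball = @enorm R n @^-1` `]0, 1]).
  by rewrite -[X in measurable X]setTI; exact: measurable_enorm.
by apply/seteqP; split => x /=; rewrite in_itv.
Qed.

Lemma punctured_ball_bounded : bounded_set punctured_ball.
Proof.
exists 1; split=> // M M1 x /andP[_ x1].
rewrite /= {1}/Num.norm/= mx_normrE; apply/bigmax_leP; split.
  by rewrite ltW// (lt_trans ltr01).
move=> [i j] _ /=; rewrite ord1; apply: le_trans (ltW M1).
apply: le_trans x1; rewrite -sqrtr_sqr ler_wsqrtr//.
rewrite /dotr (bigD1 j)//= -expr2 lerDl sumr_ge0// => k _.
by rewrite -expr2 sqr_ge0.
Qed.

(* Surface measure of the unit sphere of R^n in polar coordinates: n times the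
   volume of the cone {t x | x in A, 0 < t <= 1}. It is carried by the unit
   sphere and, for n = 3, has total mass 4 pi. *)
Definition sphere_measure (A : set 'rV[R]_n) : \bar R :=
  (n%:R%:E * lebesgue_rV R n (normalize @^-1` A `&` punctured_ball))%E.

Local Notation msph :=
  (measure_function_mscale__canonical__measure_function_Measure
    n%:R%:nng (measure_function_pushforward__canonical__measure_function_Measure
     (mrestr (lebesgue_rV R n) measurable_punctured_ball) measurable_normalize)).
HB.instance Definition _ := isMeasure.Build _ _ _ sphere_measure
  (measure0 msph) (measure_ge0 msph) (@measure_semi_sigma_additive _ _ _ msph).

Lemma sphere_measure_fin : fin_num_fun sphere_measure.
Proof.
apply: lty_fin_num_fun.
suff : (n%:R%:E * lebesgue_rV R n (normalize @^-1` setT `&` punctured_ball) < +oo)%E.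
  by [].
rewrite preimage_setT setTI lte_mul_pinfty//.
apply: lebesgue_rV_bounded; first exact: measurable_punctured_ball.
exact: punctured_ball_bounded.
Qed.

HB.instance Definition _ :=
  Measure_isFinite.Build _ _ _ sphere_measure sphere_measure_fin.

End sphere.
Arguments sphere_measure R n%_nat_scope A%_classical_set_scope : clear implicits.

Record bounded_convex_domain (R : realType) (d : nat) := BoundedConvexDomain {
  dom_set : set 'rV[R]_d ;
  dom_neq0 : dom_set !=set0 ;
  dom_open : open dom_set ;
  dom_convex : convex_set (dom_set : set (convex_lmodType 'rV[R]_d)) ;
  dom_bounded : bounded_set dom_set }.
Arguments dom_neq0 {R d} b.
Arguments dom_open {R d} b.
Arguments dom_convex {R d} b.
Arguments dom_bounded {R d} b.

Section smooth.
Variables (R : realType) (V : normedModType R).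

Fixpoint ctimes_diff (k : nat) (phi : V -> R) : Prop :=
  if k is j.+1 then
    continuous phi /\ forall v, (forall x, derivable phi x v) /\
                                ctimes_diff j (fun x => 'D_v phi x)
  else continuous phi.

Definition smooth (phi : V -> R) : Prop := forall k, ctimes_diff k phi.

End smooth.

Section phase_space.
Variables (R : realType) (d : nat) (Om : bounded_convex_domain R d).

Definition dom_measure : set 'rV[R]_d -> \bar R :=
  mrestr (lebesgue_rV R d) (open_measurable_rV (dom_open Om)).

HB.instance Definition _ := Measure.on dom_measure.

Lemma dom_measure_fin : fin_num_fun dom_measure.
Proof.
apply: lty_fin_num_fun.
suff : (lebesgue_rV R d (setT `&` dom_set Om) < +oo)%E by [].
rewrite setTI; apply: lebesgue_rV_bounded; last exact: dom_bounded.
exact: (open_measurable_rV (dom_open Om)).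
Qed.

HB.instance Definition _ :=
  Measure_isFinite.Build _ _ _ dom_measure dom_measure_fin.

Definition boundary : set 'rV[R]_d := closure (dom_set Om) `\` dom_set Om.

(* The (d-1)-dimensional Hausdorff measure of the part of a set lying in the
   boundary, used on the sigma-algebra of its Caratheodory-measurable sets. *)
Definition surface_outer : {outer_measure set 'rV[R]_d -> \bar R} :=
  restr_outer (@hausdorff R d d.-1) boundary.

Definition bndT := caratheodory_type surface_outer.

Definition surface_measure : {measure set bndT -> \bar R} :=
  surface_outer : set bndT -> \bar R.

(* The measures of D = S x Om and of S x boundary. Functions on D are functions
   on the ambient R^3 x R^d up to muD-almost-everywhere equality, and similarly
   for muB. *)
Definition muD : {measure set ('rV[R]_3 * 'rV[R]_d) -> \bar R} :=
  (sphere_measure R 3 \x dom_measure)%E.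

Definition muB : {measure set ('rV[R]_3 * bndT) -> \bar R} :=
  (sphere_measure R 3 \x^ surface_measure)%E.

Definition phase := ('rV[R]_3 * 'rV[R]_d)%type.
Definition bphase := ('rV[R]_3 * bndT)%type.

(* The first d components of s; inord is faithful because d <= 3 is assumed
   in all uses. *)
Definition proj (s : 'rV[R]_3) : 'rV[R]_d := \row_(i < d) s 0 (inord i).

(* The outer unit normal of a convex domain is its unit outward support vector,
   unique at almost every boundary point; any choice is made elsewhere. *)
Definition outer_normal (r : 'rV[R]_d) : 'rV[R]_d :=
  xget 0 [set nu | enorm nu = 1 /\
                   forall y, dom_set Om y -> dotr nu (y - r) <= 0].

Definition sn (z : bphase) : R := dotr (proj z.1) (outer_normal z.2).

Definition inflow : set bphase := [set z | sn z < 0].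

Definition ip (v w : phase -> R) : R := (\int[muD]_z (v z * w z))%R.

Definition L2D : set (phase -> R) := [set v | v \in Lfun muD 2%:E].

Definition L2_inflow : set (bphase -> R) :=
  [set t | (fun z => \1_inflow z * (Num.sqrt `|sn z| * t z)) \in Lfun muB 2%:E].

Definition reflect {T : Type} (v : 'rV[R]_3 * T -> R) : 'rV[R]_3 * T -> R :=
  fun z => v (- z.1, z.2).

Definition Vodd : set (phase -> R) :=
  [set v | L2D v /\ reflect v = \- v %[ae muD]].

(* An element w of the space W is represented together with s . grad_r w and its
   trace on S x boundary. Both are determined by w through Green's formula, so
   triples are in bijection with W, and equality in W is Wnorm (w - w') = 0. *)
Definition triple := ((phase -> R) * (phase -> R) * (bphase -> R))%type.

Definition val_of (w : triple) : phase -> R := w.1.1.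
Definition grad_of (w : triple) : phase -> R := w.1.2.
Definition trace_of (w : triple) : bphase -> R := w.2.

(* s . grad_r phi = \sum_(i < d) s_i (d phi / d r_i) *)
Definition sgrad (phi : 'rV[R]_3 * 'rV[R]_d -> R) : phase -> R := fun z =>
  \sum_(i < d) proj z.1 0 i * 'D_(0, delta_mx 0 i) phi z.

(* With phi vanishing near the boundary this says that grad_of w is the weak
   derivative of val_of w; general phi then identify the trace. *)
Definition green (w : triple) : Prop :=
  forall phi : 'rV[R]_3 * 'rV[R]_d -> R, smooth phi ->
    muB.-integrable setT (fun z => (sn z * trace_of w z * phi (z.1, z.2))%:E) /\
    (\int[muD]_z (grad_of w z * phi z + val_of w z * sgrad phi z) =
     \int[muB]_z (sn z * trace_of w z * phi (z.1, z.2)))%R.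

Definition W : set triple :=
  [set w | [/\ L2D (val_of w), L2D (grad_of w), green w & L2_inflow (trace_of w)]].

Definition Wnorm (w : triple) : R :=
  Num.sqrt (\int[muD]_z (grad_of w z ^+ 2) + \int[muD]_z (val_of w z ^+ 2) +
            \int[muB]_(z in inflow) (`|sn z| * trace_of w z ^+ 2))%R.

(* Reflecting w to w(-s, r) turns its derivative g into -g(-s, r) and its trace t
   into t(-s, r), whence the last two clauses. *)
Definition Wplus : set triple :=
  [set w | [/\ W w, reflect (val_of w) = val_of w %[ae muD],
     reflect (grad_of w) = \- grad_of w %[ae muD] &
     reflect (trace_of w) = trace_of w %[ae muB]]].

Section operators.
Variables (g : R) (sigma_a sigma_s : 'rV[R]_d -> R).

Definition hg_kernel (c : R) : R :=
  (4 * pi)^-1 * ((1 - g ^+ 2) / (1 - 2 * g * c + g ^+ 2) `^ (3 / 2)).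

Definition Sop (u : phase -> R) : phase -> R := fun z =>
  (\int[sphere_measure R 3]_s (hg_kernel (dotr z.1 s) * u (s, z.2)))%R.

Definition Kop (u : phase -> R) : phase -> R := fun z => sigma_s z.2 * Sop u z.

Definition Mop (u : phase -> R) : phase -> R :=
  fun z => (sigma_a z.2 + sigma_s z.2) * u z.

Definition MK (u : phase -> R) : phase -> R := Mop u \- Kop u.

Definition MK_invertible : Prop := exists C : R, forall v, Vodd v ->
  exists u, [/\ Vodd u, MK u = v %[ae muD],
    ip u u <= C * ip v v &
    forall u', Vodd u' -> MK u' = v %[ae muD] -> u' = u %[ae muD]].

(* The inverse of M - K on the odd functions. *)
Definition MKinv (v : phase -> R) : phase -> R :=
  xget (cst 0) [set u | Vodd u /\ MK u = v %[ae muD]].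

Definition Aop (w : triple) : phase -> R := grad_of w.

Definition Rop (u w : triple) : R :=
  (\int[muB]_z (`|sn z| * trace_of u z * trace_of w z))%R.

Definition Eop (u w : triple) : R :=
  Rop u w + ip (Aop w) (MKinv (Aop u)) + ip (Mop (val_of u)) (val_of w).

Definition EK (u w : triple) : R := Eop u w - ip (Kop (val_of u)) (val_of w).

Definition energy_norm (w : triple) : R := Num.sqrt (EK w w).

Definition odd_part (v : phase -> R) : phase -> R :=
  fun z => (v z - reflect v z) / 2.

(* As Aop w is odd and M - K preserves parity, only the odd part of q contributes
   to ((M - K)^-1 q, Aop w). *)
Definition ell (q : phase -> R) (f : bphase -> R) (w : triple) : R :=
  ip q (val_of w) + 2 * (\int[muB]_(z in inflow) (`|sn z| * f z * trace_of w z))%R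
  + ip (MKinv (odd_part q)) (Aop w).

End operators.
End phase_space.
Arguments L2D {R d} Om _.
Arguments L2_inflow {R d} Om _.
Arguments Wplus {R d} Om _.
Arguments Wnorm {R d} Om w.
Arguments EK {R d} Om g sigma_a sigma_s u w.
Arguments energy_norm {R d} Om g sigma_a sigma_s w.
Arguments ell {R d} Om g sigma_a sigma_s q f w.

(* The subspace X of V, modulo the null space of the seminorm N. *)
Section seminormed_space.
Variables (R : realType) (V : lmodType R) (X : set V) (N : V -> R).

Definition eq_in (u v : V) : Prop := N (u - v) = 0.

Definition closed_subspace (Y : set V) : Prop :=
  [/\ Y `<=` X, Y 0, (forall (a : R) u v, Y u -> Y v -> Y (a *: u + v)) &
     forall u, X u -> (forall e, 0 < e -> exists2 v, Y v & N (u - v) < e) -> Y u].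

Definition dual : set (V -> R) :=
  [set l | (forall (a : R) u v, X u -> X v -> l (a *: u + v) = a * l u + l v) /\
           exists C, forall v, X v -> `|l v| <= C * N v].

Definition eq_dual (l m : V -> R) : Prop := forall v, X v -> l v = m v.

Definition dual_norm (l : V -> R) : R :=
  sup [set `|l v| | v in [set v | X v /\ N v <= 1]].

Variable P : (V -> R) -> V.

Definition dual_operator : Prop :=
  [/\ forall l, dual l -> X (P l),
     forall (a : R) l m, dual l -> dual m ->
       eq_in (P (a *: l + m)) (a *: P l + P m) &
     exists C, forall l, dual l -> N (P l) <= C * dual_norm l].

Definition symmetric_on_dual : Prop :=
  forall l m, dual l -> dual m -> l (P m) = m (P l).

Definition positive_definite : Prop :=
  forall l, dual l -> ~ eq_dual l 0 -> 0 < l (P l).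

Variable A : V -> V -> R.

(* lambda is regular when A - lambda P^-1, as an operator on the range of P with
   values in the dual of X, has a bounded inverse: the unknown w is written P m,
   so that m = P^-1 w. The remaining lambda are the eigenvalues of
   A w = lambda P^-1 w in the sense of spectral values: in infinite dimension the
   point spectrum may be empty and does not control P A. Since A and P are
   symmetric, the spectrum is real. *)
Definition pencil_regular (lambda : R) : Prop :=
  exists C, forall l, dual l ->
    exists m, [/\ dual m, eq_dual (A (P m) - lambda *: m) l,
      dual_norm m <= C * dual_norm l &
      forall m', dual m' -> eq_dual (A (P m') - lambda *: m') l -> eq_dual m' m].

Definition pencil_spectrum : set R := [set lambda | ~ pencil_regular lambda].

End seminormed_space.

(* Main.v *)
(* Write S = (E-K) P_1, acting on the dual space, and <l, m> = l(P_1 m), an inner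
   product there for which S is symmetric.  A bounded operator that is symmetric for
   a weaker inner product is bounded for it as well, with no larger norm (Lax), so the
   resolvents at the regular points of the pencil are bounded for <., .> and the
   spectral assumption becomes beta <l, l> <= <S l, l> <= <l, l>.  In particular 0 is
   regular, whence every element of W^+ is some P_1 l and the positivity of the energy
   form follows from that of P_1.  With u - u_n = P_1 l the half step leaves the error
   P_1 (l - S l), of energy <S (I-S) l, (I-S) l> <= (1-beta)^2 <S l, l>, and the
   correction subtracts its energy-orthogonal projection onto W_N^+.  Of the transport
   problem only the symmetry and boundedness of the energy form are used. *)
Require Import Defs.
From mathcomp Require Import all_boot all_order all_algebra.
From mathcomp Require Import all_classical all_reals all_analysis.
From mathcomp Require Import measurable_realfun ess_sup_inf ring lra.
Set Implicit Arguments.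
Unset Strict Implicit.
Unset Printing Implicit Defensive.
Import Order.TTheory GRing.Theory Num.Theory.
Import numFieldNormedType.Exports.
Local Open Scope classical_set_scope.
Local Open Scope ring_scope.

(** * Symmetric forms and the spectrum of self-adjoint operators *)

(** Triples represent elements of W^+ only up to the null space of [Wnorm], and functionals matter
    only on W^+. Nothing is divided out: all forms are semidefinite on a predicate [D], and an
    equality modulo null vectors is used through the products that it determines. The dual space is
    not known to be complete for the product l (P_1 m), so spectral theorem and operator square
    roots are replaced by Cauchy-Schwarz for the forms themselves, by the growth of iterates and by
    the infimum of the upper bounds of a Rayleigh quotient. Differences such as u - u_n are taken in
    a linear space [Y] containing W^+, on which the energy form is already symmetric and bounded,
    whereas [P] and the dual only see [X] = W^+. *)

Section forms.
Variables (R : realType) (E : lmodType R) (D : set E).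

Definition submodule := D 0 /\ forall (a : R) x y, D x -> D y -> D (a *: x + y).

Definition sym_form (b : E -> E -> R) :=
  (forall x y, D x -> D y -> b x y = b y x) /\
  (forall (a : R) x y z, D x -> D y -> D z -> b (a *: x + y) z = a * b x z + b y z).

Definition psd_form b := sym_form b /\ forall x, D x -> 0 <= b x x.

Definition self_adjoint (b : E -> E -> R) (A : E -> E) :=
  (forall x, D x -> D (A x)) /\ forall x y, D x -> D y -> b (A x) y = b x (A y).

Hypothesis D_mod : submodule.

Lemma submoduleZ a x : D x -> D (a *: x).
Proof. by case: D_mod => D0 DL Dx; rewrite -[_ *: _]addr0; exact: DL. Qed.

Lemma submoduleD x y : D x -> D y -> D (x + y).
Proof. by case: D_mod => D0 DL Dx Dy; rewrite -[x]scale1r; exact: DL. Qed.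

Lemma submoduleB x y : D x -> D y -> D (x - y).
Proof.
by case: D_mod => D0 DL Dx Dy; rewrite addrC -scaleN1r; exact: DL.
Qed.

Section form.
Variable b : E -> E -> R.
Hypothesis bS : sym_form b.

Lemma sformC x y : D x -> D y -> b x y = b y x. Proof. exact: bS.1. Qed.

Lemma sformDl x y z : D x -> D y -> D z -> b (x + y) z = b x z + b y z.
Proof. by move=> *; rewrite -[x]scale1r bS.2// scale1r mul1r. Qed.

Lemma sform0l z : D z -> b 0 z = 0.
Proof.
case: D_mod => D0 _ Dz; have := @sformDl 0 0 z D0 D0 Dz.
by rewrite addr0; lra.
Qed.

Lemma sformZl a x z : D x -> D z -> b (a *: x) z = a * b x z.
Proof.
case: D_mod => D0 _ Dx Dz.
by rewrite -[_ *: _]addr0 bS.2// sform0l// addr0.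
Qed.

Lemma sformBl x y z : D x -> D y -> D z -> b (x - y) z = b x z - b y z.
Proof.
by move=> Dx Dy Dz; rewrite addrC -scaleN1r bS.2// mulN1r addrC.
Qed.

Lemma sformBr x y z : D x -> D y -> D z -> b z (x - y) = b z x - b z y.
Proof.
move=> Dx Dy Dz; rewrite sformC ?sformBl//; last exact: submoduleB.
by rewrite (sformC Dx)// (sformC Dy).
Qed.

Lemma sformZr a x z : D x -> D z -> b z (a *: x) = a * b z x.
Proof.
by move=> Dx Dz; rewrite sformC ?sformZl//; [rewrite sformC|exact: submoduleZ].
Qed.

Lemma form_sqrB x y : D x -> D y ->
  b (x - y) (x - y) = b x x - 2 * b x y + b y y.
Proof.
move=> Dx Dy; have Dxy := submoduleB Dx Dy.
by rewrite sformBl// !sformBr// (sformC Dy Dx); ring.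
Qed.

End form.

Lemma cauchy_schwarz b x y : psd_form b -> D x -> D y ->
  b x y ^+ 2 <= b x x * b y y.
Proof.
move=> [bS b0] Dx Dy.
have q t : 0 <= t ^+ 2 * b x x - 2 * t * b x y + b y y.
  have := b0 _ (submoduleB (submoduleZ t Dx) Dy).
  have Dtx := submoduleZ t Dx.
  by rewrite form_sqrB// sformZl// sformZr// sformZl//; nra.
have [xx0|xx0] := eqVneq (b x x) 0.
  rewrite xx0 mul0r; have [->|xy0] := eqVneq (b x y) 0; first by rewrite expr0n.
  (* With [b x x = 0] the quadratic [q] is affine in t; this t gives it the value -1. *)
  have := q ((b y y + 1) / (2 * b x y)).
  rewrite xx0 mulr0 add0r (_ : 2 * _ * _ = b y y + 1); first by lra.
  by field.
have xx : 0 < b x x by rewrite lt_def xx0 b0.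
have := q (b x y / b x x).
rewrite (_ : _ + _ = (b x x * b y y - b x y ^+ 2) / b x x); last by field.
by rewrite pmulr_lge0 ?invr_gt0// subr_ge0.
Qed.

Lemma self_adjoint_form b A : sym_form b -> self_adjoint b A ->
  sym_form (fun x y => b (A x) y).
Proof.
move=> bS [DA bA]; case: D_mod => D0 DL; split=> [x y Dx Dy|a x y z Dx Dy Dz].
  by rewrite bA// sformC//; exact: DA.
rewrite bA//; last exact: DL.
by rewrite bS.2// ?bA//; exact: DA.
Qed.

(** Cauchy-Schwarz for the form (A x, y), taken at x and A x, gives |A x|^4 <= (A x, x) (A A x, A x)
    <= c (A x, x) |A x|^2, and a factor |A x|^2 cancels. This is A^2 <= c A without a square root of
    A. *)
Lemma self_adjoint_sqr_le b A c : psd_form b -> self_adjoint b A -> 0 <= c ->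
  (forall x, D x -> 0 <= b (A x) x <= c * b x x) ->
  forall x, D x -> b (A x) (A x) <= c * b (A x) x.
Proof.
move=> bP bA c0 Ac x Dx; have DAx := bA.1 _ Dx.
have tP : psd_form (fun x y => b (A x) y).
  split; first exact: self_adjoint_form bP.1 bA.
  by move=> y /Ac/andP[].
have /= := cauchy_schwarz tP Dx DAx.
have /andP[x0 _] := Ac _ Dx; have /andP[_ AAx] := Ac _ DAx.
have := bP.2 _ DAx; set p := b (A x) (A x) in AAx *.
rewrite le_eqVlt => /orP[/eqP <-|p0]; first by rewrite mulr_ge0.
move=> /le_trans/(_ (ler_wpM2l x0 AAx)).
by rewrite expr2 mulrA ler_pM2r// mulrC.
Qed.

(* The squared norms of the iterates A^j x are log-convex in j, so one step that
   expanded the b-norm by more than K would force growth faster than K^j. *)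
Lemma self_adjoint_bounded b A (q : E -> R) C K :
  psd_form b -> self_adjoint b A -> 0 < K ->
  (forall x, D x -> 0 <= q x) ->
  (forall x, D x -> b x x <= C * q x ^+ 2) ->
  (forall x, D x -> q (A x) <= K * q x) ->
  forall x, D x -> b (A x) (A x) <= K ^+ 2 * b x x.
Proof.
move=> bP bA K0 q0 bq qA x Dx.
have DA j : D (iter j A x) by elim: j => // j; exact: bA.1.
pose s j := b (iter j A x) (iter j A x).
have s0 j : 0 <= s j by apply: bP.2.
have s2 j : s j.+1 ^+ 2 <= s j * s j.+2.
  rewrite (_ : s j.+1 = b (iter j A x) (iter j.+2 A x)); last first.
    by rewrite /s {1}iterS bA.2.
  exact: cauchy_schwarz.
rewrite leNgt; apply/negP => K1; rewrite -[b x x]/(s 0%N) -[b (A x) _]/(s 1%N) in K1.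
have s00 : 0 < s 0%N.
  rewrite lt_def s0 andbT; apply/eqP => s00.
  have := s2 0%N; rewrite s00 mul0r; move: K1; rewrite s00 mulr0.
  by move=> h; rewrite leNgt exprn_gt0.
pose r := s 1%N / s 0%N.
have rK : K ^+ 2 < r by rewrite ltr_pdivlMr.
have r0 : 0 < r by apply: lt_trans rK; rewrite exprn_gt0.
(* By log-convexity the ratios of successive terms never drop below the first one, [r]. *)
have sr j : 0 < s j /\ r * s j <= s j.+1.
  elim: j => [|j [sj sj1]]; first by rewrite /r divfK ?gt_eqF.
  have sj1_gt0 : 0 < s j.+1 by apply: lt_le_trans sj1; rewrite mulr_gt0.
  split=> //; have h := s2 j; rewrite -(ler_pM2l sj); apply: le_trans h.
  by rewrite mulrA expr2 ler_pM2r// mulrC.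
have s_ge j : r ^+ j * s 0%N <= s j.
  elim: j => [|j IH]; first by rewrite mul1r.
  apply: le_trans (sr j).2; rewrite exprS -mulrA ler_pM2l//.
have q_le j : q (iter j A x) <= K ^+ j * q x.
  elim: j => [|j IH]; first by rewrite mul1r.
  by rewrite (le_trans (qA _ (DA j)))// exprS -mulrA ler_pM2l.
have C0 : 0 <= `|C| by [].
have s_le j : s j <= `|C| * q x ^+ 2 * (K ^+ 2) ^+ j.
  apply: le_trans (bq _ (DA j)) _.
  apply: le_trans (_ : `|C| * q (iter j A x) ^+ 2 <= _).
    by rewrite ler_wpM2r ?sqr_ge0// ler_norm.
  rewrite -mulrA ler_wpM2l// -exprM mulnC exprM -exprMn mulrC.
  by rewrite ler_sqr ?nnegrE ?q0// ?mulr_ge0 ?exprn_ge0 ?q0// ltW.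
pose M := `|C| * q x ^+ 2 / s 0%N.
have M0 : 0 <= M by rewrite divr_ge0// mulr_ge0// sqr_ge0.
(* [rho > 1] compares two growth rates: [s j] is at least r^j s_0 and at most a constant times
   K^(2j), so the powers of [rho] stay below [M], which Bernoulli's inequality excludes. *)
pose rho := r / K ^+ 2.
have rhoM j : rho ^+ j <= M.
  rewrite exprMn exprVn ler_pdivrMr ?exprn_gt0//.
  rewrite /M mulrAC ler_pdivlMr//.
  exact: le_trans (s_ge j) (s_le j).
have rho1 : 0 < rho - 1 by rewrite subr_gt0 ltr_pdivlMr ?exprn_gt0// mul1r.
have bern j : 1 + j%:R * (rho - 1) <= rho ^+ j.
  elim: j => [|j IH]; first by rewrite mul0r addr0 expr0.
  rewrite exprS; apply: le_trans (ler_wpM2l _ IH); last by lra.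
  rewrite -natr1; have : 0 <= j%:R * (rho - 1) ^+ 2 by rewrite mulr_ge0 ?sqr_ge0.
  by nra.
pose N := (Num.truncn (M / (rho - 1))).+1.
have : M / (rho - 1) < N%:R by exact: truncnS_gt.
rewrite ltr_pdivrMr//; have := bern N; have := rhoM N.
lra.
Qed.

(* The supremum M of the Rayleigh quotient lies in the approximate spectrum: where
   A - M is bounded below, M - A >= delta > 0, so that M is not the supremum. *)
Lemma rayleigh_le b A L c : psd_form b -> self_adjoint b A ->
  (forall x, D x -> b (A x) (A x) <= L ^+ 2 * b x x) ->
  (forall lambda, c < lambda -> exists K, forall x, D x ->
     b x x <= K * b (A x - lambda *: x) (A x - lambda *: x)) ->
  forall x, D x -> b (A x) x <= c * b x x.
Proof.
move=> bP bA AL reg.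
have [bS b0] := bP; have [DA bAA] := bA.
have ub x : D x -> `|b (A x) x| <= `|L| * b x x.
  move=> Dx; rewrite -ler_sqr ?nnegrE ?mulr_ge0 ?b0// real_normK ?num_real//.
  apply: le_trans (cauchy_schwarz bP (DA _ Dx) Dx) _.
  rewrite exprMn real_normK ?num_real// [b x x ^+ 2]expr2 mulrA.
  by rewrite ler_wpM2r ?b0 ?AL.
(* The upper bounds of the Rayleigh quotient, written without dividing by [b x x], which may
   vanish. *)
pose U := [set t | forall x, D x -> b (A x) x <= t * b x x].
suff : U c by [].
have [//|Uc] := pselect (U c).
have Uup t t' : U t -> t <= t' -> U t'.
  move=> Ut tt' x Dx; apply: le_trans (Ut x Dx) _.
  by rewrite ler_wpM2r ?b0.
have Ulb t : U t -> c < t.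
  by move=> Ut; rewrite ltNge; apply/negP => /(Uup _ _ Ut).
have U0 : U !=set0.
  by exists `|L| => x Dx; apply: le_trans (ub _ Dx); exact: ler_norm.
have UI : has_inf U by split=> //; exists c => t /Ulb/ltW.
pose M := inf U.
have UM : U M.
  move=> x Dx; apply/ler_addgt0Pr => e e0.
  have bx1 : 0 < b x x + 1 by rewrite ltr_wpDl ?b0.
  have [t Ut tM] := inf_adherent (divr_gt0 e0 bx1) UI.
  apply: le_trans (Ut x Dx) _.
  apply: le_trans (_ : (M + e / (b x x + 1)) * b x x <= _).
    by rewrite ler_wpM2r ?b0// ltW.
  rewrite mulrDl lerD2l mulrAC ler_pdivrMr// ler_pM2l//.
  by rewrite lerDl.
have cM : c < M by exact: Ulb.
have [K0 regM0] := reg _ cM.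
pose K := `|K0| + 1.
have K_gt0 : 0 < K by rewrite ltr_wpDl.
pose B x := M *: x - A x.
have DB x : D x -> D (B x).
  by move=> Dx; apply: submoduleB; [exact: submoduleZ|exact: DA].
have BP : self_adjoint b B.
  split=> // x y Dx Dy; have DMx := submoduleZ M Dx; have DMy := submoduleZ M Dy.
  by rewrite sformBl ?sformBr ?sformZl ?sformZr ?bAA//; exact: DA.
have bB x : D x -> b (B x) x = M * b x x - b (A x) x.
  move=> Dx; have DMx := submoduleZ M Dx.
  by rewrite sformBl ?sformZl//; exact: DA.
(* [c'] bounds B = M - A from above, so that |B x|^2 <= c' (B x, x) and the lower bound on |B x|
   becomes one on the form of [B]. *)
pose c' := `|M| + `|L| + 1.
have c'0 : 0 < c' by rewrite ltr_wpDl// addr_ge0.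
have Bc x : D x -> 0 <= b (B x) x <= c' * b x x.
  move=> Dx; rewrite bB// subr_ge0 UM//=.
  have := ub _ Dx; rewrite ler_norml => /andP[h _].
  have h2 : M * b x x <= `|M| * b x x by rewrite ler_wpM2r ?b0// ler_norm.
  have := b0 _ Dx; rewrite /c'; nra.
have BB x : D x -> b x x <= K * c' * b (B x) x.
  move=> Dx; have := regM0 _ Dx.
  have -> : A x - M *: x = (-1) *: B x by rewrite scaleN1r opprB.
  have DBx := DB _ Dx.
  rewrite sformZl// ?sformZr// ?mulrA ?mulrNN ?mulr1 ?mul1r; last exact: submoduleZ.
  move=> /le_trans; apply.
  apply: le_trans (_ : K * b (B x) (B x) <= _).
    by rewrite ler_wpM2r ?b0// /K; have := ler_norm K0; lra.
  rewrite -mulrA ler_pM2l//; exact: self_adjoint_sqr_le (ltW c'0) Bc _ _.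
have Kc0 : 0 < K * c' by rewrite mulr_gt0.
(* B >= 1 / (K c') lowers the upper bound [M] of [A] by that amount, against the choice of [M] as
   infimum. *)
have : U (M - (K * c')^-1).
  move=> x Dx; have := BB _ Dx; rewrite bB// -ler_pdivrMl//.
  by lra.
move=> /(ge_inf UI.2); rewrite -/M.
have : 0 < (K * c')^-1 by rewrite invr_gt0.
lra.
Qed.

(** For the product t(x, y) = (A x, y) the operator Q = 1 - A is symmetric and lies between 0 and 1
    - beta, because beta A <= A^2 <= A. Hence t(Q x, Q x) <= (1 - beta) t(Q x, x) <= (1 - beta)^2
    t(x, x). *)
Lemma form_contraction b A beta : psd_form b -> self_adjoint b A ->
  0 < beta <= 1 ->
  (forall x, D x -> beta * b x x <= b (A x) x <= b x x) ->
  forall x, D x -> b (A (x - A x)) (x - A x) <= (1 - beta) ^+ 2 * b (A x) x.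
Proof.
move=> bP bA /andP[beta0 beta1] hA.
have [bS b0] := bP; have [DA bAA] := bA.
have A0 x : D x -> 0 <= b (A x) x <= 1 * b x x.
  move=> Dx; have /andP[h1 h2] := hA _ Dx; rewrite mul1r h2 andbT.
  by apply: le_trans h1; rewrite mulr_ge0 ?b0// ltW.
pose t x y := b (A x) y.
have tP : psd_form t.
  split; first exact: self_adjoint_form bS bA.
  by move=> x /A0/andP[].
have AA1 x : D x -> b (A x) (A x) <= b (A x) x.
  by move=> Dx; rewrite -[leRHS]mul1r; exact: self_adjoint_sqr_le ler01 A0 _ _.
(* beta (A x, x)^2 <= beta |A x|^2 |x|^2 <= |A x|^2 (A x, x); divide by (A x, x) unless it is 0. *)
have AA2 x : D x -> beta * b (A x) x <= b (A x) (A x).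
  move=> Dx; have := cauchy_schwarz bP (DA _ Dx) Dx.
  have /andP[Ax0 _] := A0 _ Dx; have /andP[hb _] := hA _ Dx.
  have [<-|Ax] := eqVneq 0 (b (A x) x).
    by rewrite mulr0 => _; apply/b0/DA.
  have Axp : 0 < b (A x) x by rewrite lt_def eq_sym Ax.
  rewrite expr2 => h; rewrite -(ler_pM2r Axp) -mulrA.
  apply: le_trans (ler_wpM2l (ltW beta0) h) _.
  by rewrite mulrCA ler_wpM2l// b0//; exact: DA.
pose Q x := x - A x.
have DQ x : D x -> D (Q x) by move=> Dx; apply: submoduleB => //; exact: DA.
have QS : self_adjoint t Q.
  split=> // x y Dx Dy; rewrite /t.
  rewrite bAA//; last exact: DQ.
  have DAx := DA _ Dx; have DAy := DA _ Dy.
  by rewrite sformBl// (sformBr bS)// (bAA x y).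
have tQ x : D x -> t (Q x) x = b (A x) x - b (A x) (A x).
  move=> Dx; have DAx := DA _ Dx.
  by rewrite /t bAA ?sformBl// ?bAA//; exact: DQ.
have b10 : 0 <= 1 - beta by lra.
have Qc x : D x -> 0 <= t (Q x) x <= (1 - beta) * t x x.
  move=> Dx; rewrite tQ// subr_ge0 AA1//= /t.
  have := AA2 _ Dx; lra.
move=> x Dx; apply: le_trans (self_adjoint_sqr_le tP QS b10 Qc Dx) _.
by rewrite expr2 -mulrA ler_wpM2l//; case/andP: (Qc _ Dx).
Qed.

End forms.

(** * The two-level iteration for a bounded symmetric form *)

Section two_level.
Variables (R : realType) (V : lmodType R) (X Y : set V) (N : V -> R).
Variables (p a : V -> V -> R) (C : R) (P : (V -> R) -> V).
Hypotheses (XY : X `<=` Y) (X0 : X 0) (Y_mod : submodule Y).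
Hypotheses (pP : psd_form Y p) (N_ge0 : forall v, 0 <= N v).
Hypothesis N_sqr : forall v, Y v -> N v ^+ 2 = p v v.
Hypotheses (aS : sym_form Y a) (C_ge0 : 0 <= C).
Hypothesis a_bnd : forall u v, Y u -> Y v -> `|a u v| <= C * (N u * N v).
Hypotheses (P_op : dual_operator X N P) (P_sym : symmetric_on_dual X N P).
Hypothesis P_pos : positive_definite X N P.

Local Notation dual := (dual X N).
Local Notation dual_norm := (dual_norm X N).
Local Notation eq_dual := (eq_dual X).

Lemma seminorm_cauchy_schwarz u v : Y u -> Y v -> `|p u v| <= N u * N v.
Proof.
move=> Yu Yv; rewrite -ler_sqr ?nnegrE ?mulr_ge0//.
by rewrite exprMn !N_sqr// real_normK ?num_real//; exact: (cauchy_schwarz Y_mod pP).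
Qed.

(** Equality modulo null vectors cannot be rewritten with; equality of all [p]-products can, and
    [ring] and [lra] apply to it. *)
Lemma null_subP u v : Y u -> Y v ->
  N (u - v) = 0 <-> forall w, Y w -> p u w = p v w.
Proof.
move=> Yu Yv; have Yuv := submoduleB Y_mod Yu Yv; split=> [uv0 w Yw|puv].
  apply/eqP; rewrite -subr_eq0 -(sformBl pP.1)// -normr_le0.
  by have := seminorm_cauchy_schwarz Yuv Yw; rewrite uv0 mul0r.
apply/eqP; rewrite -sqrf_eq0 N_sqr// (sformBl pP.1)// puv//.
by rewrite subrr.
Qed.

Lemma null_sub_form u v w : Y u -> Y v -> Y w -> N (u - v) = 0 -> a u w = a v w.
Proof.
move=> Yu Yv Yw uv0; have Yuv := submoduleB Y_mod Yu Yv.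
apply/eqP; rewrite -subr_eq0 -(sformBl aS)// -normr_le0.
by have := a_bnd Yuv Yw; rewrite uv0 mul0r mulr0.
Qed.

Lemma dual_submodule : submodule dual.
Proof.
split.
  split=> [t u v _ _|]; first by rewrite /= mulr0 addr0.
  by exists 0 => v _; rewrite normr0 mul0r.
move=> t l m [lL [Cl lB]] [mL [Cm mB]]; split=> [s u v Xu Xv|].
  rewrite -[LHS]/(t * l _ + m _) -[RHS]/(s * (t * l u + m u) + (t * l v + m v)).
  by rewrite lL// mL//; ring.
exists (`|t| * Cl + Cm) => v Xv; rewrite -[X in `|X|]/(t * l v + m v).
rewrite (le_trans (ler_normD _ _))// normrM mulrDl lerD ?mB// -mulrA.
by rewrite ler_wpM2l// lB.
Qed.

Lemma bounded_form_dual (f : V -> V -> R) (K : R) y :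
  sym_form Y f -> Y y ->
  (forall v, Y v -> `|f y v| <= K * N v) -> dual (f y).
Proof.
move=> fS Yy fB; split=> [t u v Xu Xv|]; last by exists K => v /XY; exact: fB.
have Yu := XY Xu; have Yv := XY Xv; case: Y_mod => _ YL.
by rewrite (fS.1 y)//; [rewrite fS.2// !(fS.1 y)|exact: YL].
Qed.

Lemma dual_p y : Y y -> dual (p y).
Proof.
move=> Yy; apply: (bounded_form_dual pP.1 Yy) => v Yv.
exact: seminorm_cauchy_schwarz.
Qed.

Lemma dual_a y : Y y -> dual (a y).
Proof.
move=> Yy; apply: (@bounded_form_dual _ (C * N y)) => // v Yv.
by rewrite -mulrA a_bnd.
Qed.

Let ball_image (l : V -> R) := [set `|l v| | v in [set v | X v /\ N v <= 1]].

Lemma seminorm0 : N 0 = 0.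
Proof.
case: (Y_mod) => Y0 _; apply/eqP.
by rewrite -sqrf_eq0 N_sqr// (sform0l Y_mod pP.1).
Qed.

Lemma ball_image_neq0 l : ball_image l !=set0.
Proof. by exists `|l 0|, 0 => //=; rewrite seminorm0 ler01. Qed.

Lemma dual_norm_ub l v : dual l -> X v -> N v <= 1 -> `|l v| <= dual_norm l.
Proof.
move=> [_ [K lK]] Xv v1; apply: ub_le_sup; last by exists v.
exists `|K| => _ [w [Xw w1] <-]; apply: le_trans (lK _ Xw) _.
have h : K * N w <= `|K| * N w by rewrite ler_wpM2r// ler_norm.
by apply: le_trans h _; rewrite -[leRHS]mulr1 ler_wpM2l.
Qed.

Lemma dual_norm_ge0 l : dual l -> 0 <= dual_norm l.
Proof.
move=> Dl; apply: le_trans (_ : `|l 0| <= _) => //.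
by apply: dual_norm_ub => //; rewrite seminorm0 ler01.
Qed.

Lemma dual_norm_le l M : 0 <= M -> (forall v, X v -> N v <= 1 -> `|l v| <= M) ->
  dual_norm l <= M.
Proof.
move=> M0 lM; apply: ge_sup; first exact: ball_image_neq0.
by move=> _ [v [Xv v1] <-]; exact: lM.
Qed.

Lemma dual_norm_bound l M : 0 <= M -> (forall v, X v -> `|l v| <= M * N v) ->
  dual_norm l <= M.
Proof.
move=> M0 lM; apply: dual_norm_le => // v Xv v1.
by apply: le_trans (lM _ Xv) _; rewrite -[leRHS]mulr1 ler_wpM2l.
Qed.

Lemma dual_normZ t l : dual l -> dual_norm (t *: l) <= `|t| * dual_norm l.
Proof.
move=> Dl; apply: dual_norm_le => [|v Xv v1].
  by rewrite mulr_ge0 ?dual_norm_ge0.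
rewrite -[X in `|X|]/(t * l v) normrM ler_wpM2l//; exact: dual_norm_ub.
Qed.

Lemma dual_operator_bounded :
  exists2 K, 0 < K & forall l, dual l -> N (P l) <= K * dual_norm l.
Proof.
case: P_op => _ _ [K PK]; exists (`|K| + 1); first by rewrite ltr_wpDl.
move=> l Dl; apply: le_trans (PK _ Dl) _; rewrite ler_wpM2r ?dual_norm_ge0//.
by have := ler_norm K; lra.
Qed.

Lemma dual_operator_mem l : dual l -> X (P l).
Proof. by case: P_op => + _ _; exact. Qed.

Let XP := dual_operator_mem.
Let YP l (Dl : dual l) : Y (P l) := XY (XP Dl).

Lemma dual_operator_linear t l m w : dual l -> dual m -> Y w ->
  p (P (t *: l + m)) w = t * p (P l) w + p (P m) w.
Proof.
move=> Dl Dm Yw; case: (P_op) => _ PL _; case: dual_submodule => _ DL.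
have Dtlm : dual (t *: l + m) by exact: DL.
have YL : Y (t *: P l + P m) by apply: Y_mod.2; exact: YP.
have h := (null_subP (YP Dtlm) YL).1 (PL t _ _ Dl Dm).
by rewrite h// pP.1.2//; exact: YP.
Qed.

(** Functionals are functions on all of [V], and [P] could a priori tell apart two that agree on
    [X]. Their difference has dual norm 0, so boundedness of [P] makes its image null. *)
Lemma dual_operator_ext l m w : dual l -> dual m -> eq_dual l m -> Y w ->
  p (P l) w = p (P m) w.
Proof.
move=> Dl Dm lm Yw; have [K K0 PK] := dual_operator_bounded.
have Dd : dual (-1 *: m + l) by apply: dual_submodule.2.
have d0 : N (P (-1 *: m + l)) = 0.
  apply/eqP; rewrite eq_le N_ge0 andbT (le_trans (PK _ Dd))//.
  rewrite pmulr_rle0//; apply: dual_norm_le => // v Xv _.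
  rewrite -[X in `|X|]/(-1 * m v + l v) lm// mulN1r addNr normr0//.
have := dual_operator_linear (-1) Dm Dl Yw.
have := seminorm_cauchy_schwarz (YP Dd) Yw.
by rewrite d0 mul0r normr_le0 => /eqP ->; lra.
Qed.

Let b (l m : V -> R) := l (P m).

Lemma dual_form_psd : psd_form dual b.
Proof.
split; first split.
- by move=> l m Dl Dm; exact: P_sym.
(* Linearity in the evaluated functional is definitional; linearity in the slot of [P] then follows
   from symmetry. *)
- by [].
- move=> l Dl; have [l0|l0] := pselect (eq_dual l 0).
    by rewrite /b l0//; exact: XP.
  by apply/ltW/P_pos.
Qed.

Let bP := dual_form_psd.

(** [dual_norm] controls values on the unit ball only. Scaling by [t] brings [P (t *: l)] into the
    ball, and symmetry takes [t] out of [P] again. If the dual norm is 0, then [P l] is a null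
    vector, on which [l] vanishes. *)
Lemma dual_form_le : exists K, forall l, dual l -> b l l <= K * dual_norm l ^+ 2.
Proof.
have [K K0 PK] := dual_operator_bounded; exists K => l Dl.
have := dual_norm_ge0 Dl; rewrite le_eqVlt => /orP[/eqP q0|q0].
  have := PK _ Dl; rewrite -q0 mulr0 expr0n mulr0 => N0.
  have {}N0 : N (P l) = 0 by apply/eqP; rewrite eq_le N0/=.
  case: (Dl) => _ [Cl /(_ _ (XP Dl))]; rewrite N0 mulr0 => h.
  exact: le_trans (ler_norm _) h.
pose t := (K * dual_norm l)^-1.
have Kq0 : 0 < K * dual_norm l by rewrite mulr_gt0.
have t0 : 0 < t by rewrite invr_gt0.
have Dt : dual (t *: l) by exact: (submoduleZ dual_submodule).
have : `|l (P (t *: l))| <= dual_norm l.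
  apply: dual_norm_ub; [by []|exact: XP|].
  apply: le_trans (PK _ Dt) _.
  apply: le_trans (ler_wpM2l (ltW K0) (dual_normZ _ Dl)) _.
  by rewrite gtr0_norm// mulrCA mulVf ?gt_eqF.
rewrite P_sym// -[X in `|X|]/(t * b l l) => /(le_trans (ler_norm _)).
by rewrite ler_pdivrMl// expr2 mulrA.
Qed.

Let S l := a (P l).

(** By symmetry of [P] and [a], both sides are the energy product [a (P l) (P m)]. *)
Lemma preconditioned_self_adjoint : self_adjoint dual b S.
Proof.
split=> [l Dl|l m Dl Dm]; first by apply/dual_a/YP.
rewrite /b /S [RHS]P_sym//; last by apply/dual_a/YP.
by apply: aS.1; exact: YP.
Qed.

Let SA := preconditioned_self_adjoint.

Lemma preconditioned_bounded :
  exists L, forall l, dual l -> b (S l) (S l) <= L ^+ 2 * b l l.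
Proof.
have [K K0 PK] := dual_operator_bounded; have [M bM] := dual_form_le.
have CK : 0 < C * K + 1 by rewrite ltr_wpDl// mulr_ge0// ltW.
exists (C * K + 1).
apply: (self_adjoint_bounded dual_submodule bP SA CK dual_norm_ge0 bM).
move=> l Dl; have q0 := dual_norm_ge0 Dl.
apply: dual_norm_bound => [|v Xv]; first by rewrite mulr_ge0// ltW.
apply: le_trans (a_bnd (YP Dl) (XY Xv)) _; rewrite mulrA ler_wpM2r//.
apply: le_trans (ler_wpM2l C_ge0 (PK _ Dl)) _.
by rewrite mulrA ler_wpM2r// lerDl.
Qed.

Lemma preconditioned_shift_self_adjoint lambda :
  self_adjoint dual b (fun l => S l - lambda *: l).
Proof.
have Dm := dual_submodule.
split=> [l Dl|l m Dl Dm'].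
  by apply: submoduleB => //; [exact: SA.1|exact: submoduleZ].
have DSl := SA.1 _ Dl; have DSm := SA.1 _ Dm'.
have Dll := submoduleZ Dm lambda Dl; have Dlm := submoduleZ Dm lambda Dm'.
rewrite (sformBl bP.1)// (sformBr Dm bP.1)// (sformZl Dm bP.1)//.
by rewrite (sformZr Dm bP.1)// SA.2.
Qed.

(** Symmetry turns [m], which enters through [P m], into a functional evaluated on [X], where it may
    be replaced. *)
Lemma form_eq_dual_r l m m' : dual l -> dual m -> dual m' -> eq_dual m m' ->
  b l m = b l m'.
Proof.
by move=> Dl Dm Dm' mm'; rewrite !(sformC bP.1 Dl)// /b mm'//; exact: XP.
Qed.

(** The resolvent [G] at [lambda] is symmetric for [b] because [T] is, and bounded in the dual norm,
    hence bounded for [b]. That bound, applied to l = [G (T l)], is the claim. *)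
Lemma regular_bounded_below lambda : pencil_regular X N P a lambda ->
  exists K, forall l, dual l ->
    b l l <= K * b (S l - lambda *: l) (S l - lambda *: l).
Proof.
move=> [K0 reg].
have TA := preconditioned_shift_self_adjoint lambda.
set T := fun l => _ in TA.
have /choice[G GP] l : exists m, dual l -> [/\ dual m, eq_dual (T m) l,
      dual_norm m <= K0 * dual_norm l &
      forall m', dual m' -> eq_dual (T m') l -> eq_dual m' m].
  have [/reg[m ?]|nl] := pselect (dual l); first by exists m.
  by exists 0.
have DG l : dual l -> dual (G l) by case/GP.
have GA : self_adjoint dual b G.
  split=> // l m Dl Dm; have Gl := DG _ Dl; have Gm := DG _ Dm.
  have [_ Tl _ _] := GP _ Dl; have [_ Tm _ _] := GP _ Dm.
  have TGl := TA.1 _ Gl; have TGm := TA.1 _ Gm.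
  rewrite -(form_eq_dual_r Gl TGm Dm Tm) -TA.2// (sformC bP.1)//.
  by rewrite (form_eq_dual_r Gm TGl Dl Tl) (sformC bP.1).
have [M bM] := dual_form_le.
pose K := `|K0| + 1; have K_gt0 : 0 < K by rewrite ltr_wpDl.
exists (K ^+ 2) => l Dl; have DTl := TA.1 _ Dl.
have DGT := DG _ DTl.
have [_ _ _ uniqG] := GP _ DTl.
(* The uniqueness clause of regularity makes [G] a left inverse of [T] as well. *)
have lG : eq_dual l (G (T l)) by exact: uniqG.
rewrite (form_eq_dual_r Dl Dl DGT lG) (sformC bP.1)//.
rewrite (form_eq_dual_r DGT Dl DGT lG).
apply: (self_adjoint_bounded dual_submodule bP GA K_gt0 dual_norm_ge0 bM) => //.
move=> m Dm; have [_ _ qm _] := GP _ Dm; apply: le_trans qm _.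
by rewrite ler_wpM2r ?dual_norm_ge0//; have := ler_norm K0; rewrite /K; lra.
Qed.

Variable beta : R.
Hypothesis beta01 : 0 < beta <= 1.
Hypothesis spectrum : forall lambda,
  pencil_spectrum X N P a lambda -> beta <= lambda <= 1.

Lemma regular_off lambda : (lambda < beta) || (1 < lambda) ->
  pencil_regular X N P a lambda.
Proof.
move=> lb; apply: contrapT => /spectrum/andP[h1 h2].
by case/orP: lb; rewrite ltNge ?h1 ?h2.
Qed.

Lemma preconditioned_spectral_bounds l : dual l ->
  beta * b l l <= b (S l) l <= b l l.
Proof.
have Dm := dual_submodule; have [L SL] := preconditioned_bounded.
move=> Dl; apply/andP; split; last first.
  rewrite -[leRHS]mul1r; apply: (rayleigh_le Dm bP SA SL) => // lambda l1.
  by apply/regular_bounded_below/regular_off; rewrite l1 orbT.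
(* The lower bound for S is the upper bound -beta for -S: the points above -beta for -S are minus
   the points below beta for S. *)
pose A m := -1 *: S m.
have AP : self_adjoint dual b A.
  split=> [m /SA.1|m n Dm' Dn]; first exact: submoduleZ.
  have DSm := SA.1 _ Dm'; have DSn := SA.1 _ Dn.
  by rewrite (sformZl Dm bP.1)// (sformZr Dm bP.1)// SA.2.
suff : b (A l) l <= - beta * b l l.
  by have DSl := SA.1 _ Dl; rewrite (sformZl Dm bP.1)//; lra.
have AL m : dual m -> b (A m) (A m) <= L ^+ 2 * b m m.
  move=> Dm'; have DSm := SA.1 _ Dm'; have DA := submoduleZ Dm (-1) DSm.
  by rewrite (sformZl Dm bP.1)// (sformZr Dm bP.1)// !mulN1r opprK SL.
apply: (rayleigh_le Dm bP AP AL) => // lambda l1.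
have [|K hK] := @regular_bounded_below (- lambda).
  by apply: regular_off; rewrite ltrNl l1.
exists K => m Dm'.
have DT := (preconditioned_shift_self_adjoint (- lambda)).1 _ Dm'.
have -> : A m - lambda *: m = -1 *: (S m - - lambda *: m).
  by rewrite /A !scaleNr !scale1r opprD !opprK.
rewrite (sformZl Dm bP.1)// ?(sformZr Dm bP.1)// ?mulN1r ?opprK ?hK//.
exact: submoduleZ.
Qed.

(* As 0 is regular, S = A P is onto the dual; pairing u - P m with the range of P
   shows that it vanishes. *)
Lemma dual_operator_onto u : X u -> exists2 m, dual m & N (u - P m) = 0.
Proof.
move=> Xu; have Yu := XY Xu.
have [|K reg] := @regular_off 0; first by case/andP: beta01 => ->.
have [m [Dm Sm _ _]] := reg _ (dual_a Yu).
exists m => //; have Ym := YP Dm.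
have Yy := submoduleB Y_mod Yu Ym.
have [n [Dn Sn _ _]] := reg _ (dual_p Yy).
have Yn := YP Dn.
have {}Sm v : X v -> a (P m) v = a u v.
  by move=> /Sm <-; rewrite scale0r subr0.
have {}Sn v : X v -> a (P n) v = p (u - P m) v.
  by move=> /Sn <-; rewrite scale0r subr0.
(* The square of [N (u - P m)] is [a (P n) u - a (P n) (P m)], and [u] and [P m] have the same
   energy products with elements of [X]. *)
apply/eqP; rewrite -sqrf_eq0 N_sqr// (sformBr Y_mod pP.1)// -!Sn//; last exact: XP.
by rewrite !(sformC aS Yn)// Sm ?subrr//; exact: XP.
Qed.

Lemma two_level_contraction (Z : set V) (ell : V -> R) (u w wh wc w' : V) :
  Z `<=` X ->
  (forall (t : R) v v', Y v -> Y v' -> ell (t *: v + v') = t * ell v + ell v') ->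
  X u -> (forall v, X v -> a u v = ell v) ->
  X w -> X wh -> X w' -> Z wc ->
  N (wh - (w - P (a w - ell))) = 0 ->
  (forall v, Z v -> a wc v = (a (P (a w - ell)) - (a w - ell)) v) ->
  N (w' - (wh + wc)) = 0 ->
  Num.sqrt (a (u - w') (u - w')) <= (1 - beta) * Num.sqrt (a (u - w) (u - w)).
Proof.
move=> ZX ellL Xu au Xw Xwh Xw' Zc half corr full.
have Dm := dual_submodule; have Xc := ZX _ Zc.
have [Yu Yw Ywh Yw' Yc] : [/\ Y u, Y w, Y wh, Y w' & Y wc] by split; exact: XY.
have Ye := submoduleB Y_mod Yu Yw.
pose r := a w - ell; rewrite -/r in half corr.
have re v : X v -> r v = - a (u - w) v.
  move=> Xv; have Yv := XY Xv.
  by rewrite -[LHS]/(a w v - ell v) -au// (sformBl aS)// opprB.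
(* [ell] is only assumed linear; the residual is bounded because it equals -a (u - w) on [X]. *)
have Dr : dual r.
  have [_ [K aK]] := dual_a Ye.
  split=> [t v v' Xv Xv'|]; last by exists K => v Xv; rewrite re// normrN aK.
  rewrite -[LHS]/(a w _ - ell _) -[RHS]/(t * (a w v - ell v) + (a w v' - ell v')).
  have [awL _] := dual_a Yw.
  by rewrite awL// ellL; [ring|exact: XY|exact: XY].
(* [u] and [w] get preimages separately, as u - w is only known to lie in [Y]; then [P k] stands for
   u - w. *)
have [l Dl ul] := dual_operator_onto Xu.
have [m Dm' wm] := dual_operator_onto Xw.
have {}ul := (null_subP Yu (YP Dl)).1 ul.
have {}wm := (null_subP Yw (YP Dm')).1 wm.
pose k := -1 *: m + l.
have Dk : dual k by exact: Dm.2.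
have Yk := YP Dk; have Yr := YP Dr.
have pk v : Y v -> p (P k) v = p (u - w) v.
  move=> Yv; rewrite dual_operator_linear// (sformBl pP.1)// ul// wm//.
  by rewrite mulN1r addrC.
have ak v : Y v -> a (P k) v = a (u - w) v.
  by move=> Yv; apply: null_sub_form => //; exact/null_subP.
(* [P n] will stand for u - wh, the error after the half step. *)
pose n := k - S k.
have Dn : dual n by apply: submoduleB => //; exact: SA.1.
have Drk : dual (1 *: r + k) by exact: Dm.2.
have nr : eq_dual n (1 *: r + k).
  move=> v Xv; rewrite -[LHS]/(k v - a (P k) v) -[RHS]/(1 * r v + k v).
  by rewrite re// ak ?mul1r; [rewrite addrC|exact: XY].
have pn v : Y v -> p (P n) v = p (P r) v + p (u - w) v.
  move=> Yv; rewrite (dual_operator_ext Dn Drk)// dual_operator_linear//.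
  by rewrite pk// mul1r.
have Yn := YP Dn.
have Yh := submoduleB Y_mod Yw Yr.
have an v : Y v -> a (P n) v = a (P r) v + a (u - w) v.
  have Yre := submoduleD Y_mod Yr Ye.
  move=> Yv; rewrite -(sformDl aS)//; apply: null_sub_form => //.
  by apply/null_subP => // z Yz; rewrite (sformDl pP.1 Yr Ye Yz) pn.
have Ye' := submoduleB Y_mod Yu Yw'.
have Ync := submoduleB Y_mod Yn Yc.
have e'n v : Y v -> a (u - w') v = a (P n - wc) v.
  move=> Yv; apply: null_sub_form => //; apply/null_subP => // z Yz.
  have Yhc := submoduleD Y_mod Ywh Yc.
  have fz := (null_subP Yw' Yhc).1 full z Yz.
  have hz := (null_subP Ywh Yh).1 half z Yz.
  rewrite (sformBl pP.1 Yu Yw' Yz) (sformBl pP.1 Yn Yc Yz) pn// fz.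
  rewrite (sformBl pP.1 Yu Yw Yz) (sformDl pP.1 Ywh Yc Yz) hz.
  by rewrite (sformBl pP.1 Yw Yr Yz); ring.
(* The correction makes [P n - wc] energy-orthogonal to [Z]. Tested with [wc], this gives [P n - wc]
   the energy of [P n] minus that of [wc], and [cc0] lets the latter be dropped. *)
have nc : a (P n) wc = a wc wc.
  rewrite an// corr// -[RHS]/(a (P r) wc - r wc) re//.
  by rewrite opprK.
have cc0 : 0 <= a wc wc.
  have [i Di ci] := dual_operator_onto Xc; have Yi := YP Di.
  rewrite (null_sub_form Yc Yi Yc ci) (sformC aS)// (null_sub_form Yc Yi Yi ci).
  have /andP[h _] := preconditioned_spectral_bounds Di.
  have /andP[/ltW beta0 _] := beta01.
  exact: le_trans (mulr_ge0 beta0 (bP.2 _ Di)) h.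
have b10 : 0 <= 1 - beta by case/andP: beta01; lra.
have ek : a (u - w) (u - w) = b (S k) k.
  by rewrite -ak// (sformC aS)// -ak.
have contr : a (u - w') (u - w') <= (1 - beta) ^+ 2 * a (u - w) (u - w).
  rewrite e'n// (sformC aS)// e'n// (form_sqrB Y_mod aS)// nc.
  rewrite ek; apply: le_trans (form_contraction Dm bP SA beta01 _ Dk); last first.
    by move=> i; exact: preconditioned_spectral_bounds.
  rewrite -/n -[leRHS]/(a (P n) (P n)).
  lra.
rewrite -[1 - beta]ger0_norm// -sqrtr_sqr -sqrtrM ?sqr_ge0//.
exact: ler_wsqrtr.
Qed.

End two_level.

(** * Square-integrable functions and integral operators *)

Section L2.
Context d (T : measurableType d) (R : realType).
Variable mu : {measure set T -> \bar R}.
Implicit Types f g h : T -> R.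

Definition L2 : set (T -> R) := [set f | f \in Lfun mu 2%:E].
Definition inner f g := (\int[mu]_z (f z * g z))%R.

Lemma L2_measurable f : L2 f -> measurable_fun setT f.
Proof. by rewrite /L2/= inE => /andP[/[!inE]]. Qed.

Lemma L2P f : measurable_fun setT f -> (\int[mu]_z (f z ^+ 2)%:E < +oo)%E -> L2 f.
Proof.
move=> mf foo; rewrite /L2/= inE; apply/andP; split; rewrite inE//=.
rewrite /finite_norm unlock poweR_lty//; apply: le_lt_trans foo.
rewrite le_eqVlt; apply/orP; left; apply/eqP/eq_integral => z _ /=.
by rewrite powR_mulrn// -normrX ger0_norm ?sqr_ge0.
Qed.

Lemma L2_sqr_lty f : L2 f -> (\int[mu]_z (f z ^+ 2)%:E < +oo)%E.
Proof.
move=> /Lfun2_integrable_sqr/integrableP[_]; apply: le_lt_trans.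
rewrite le_eqVlt; apply/orP; left; apply/eqP/eq_integral => z _ /=.
by rewrite ger0_norm ?sqr_ge0.
Qed.

Lemma L2_mul_integrable f g : L2 f -> L2 g ->
  mu.-integrable setT (fun z => (f z * g z)%:E).
Proof. by move=> f2 g2; have /Lfun1_integrable := Lfun2_mul_Lfun1 f2 g2. Qed.

Lemma L2_submodule : submodule L2.
Proof.
have [h0 hL] := Lfun_submod_closed mu (lee1n 2 : (1 <= 2%:E :> \bar R)%E).
by split=> // a f g; exact: hL.
Qed.

Lemma inner_psd : psd_form L2 inner.
Proof.
split; first split.
- by move=> f g _ _; apply: eq_Rintegral => z _; rewrite mulrC.
- move=> a f g h f2 g2 h2.
  rewrite /inner -RintegralZl//; last exact: L2_mul_integrable.
  rewrite -RintegralD//; last exact: L2_mul_integrable.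
  + by apply: eq_Rintegral => z _; rewrite -[X in X * _]/(a * f z + g z); ring.
  + have af2 := submoduleZ L2_submodule a f2.
    apply: eq_integrable (L2_mul_integrable af2 h2) => // z _ /=.
    by rewrite -[X in (X * _)%:E]/(a * f z) mulrA.
- by move=> f _; apply: Rintegral_ge0 => z _; rewrite -expr2 sqr_ge0.
Qed.

Lemma inner_EFin f : L2 f -> (\int[mu]_z (f z ^+ 2)%:E)%E = (inner f f)%:E.
Proof.
move=> f2; rewrite /inner /Rintegral fineK ?ge0_fin_numE//; first exact: L2_sqr_lty.
by apply: integral_ge0 => z _; rewrite lee_fin -expr2 sqr_ge0.
Qed.

Lemma inner_ae_eq f f' g : L2 f -> L2 f' -> L2 g -> f = f' %[ae mu] ->
  inner f g = inner f' g.
Proof.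
move=> f2 f2' g2 ff'; congr fine; apply: ae_eq_integral => //.
- exact: measurable_int (L2_mul_integrable f2 g2).
- exact: measurable_int (L2_mul_integrable f2' g2).
- by apply: filterS ff' => z /= + _ => ->.
Qed.

Lemma L2_bounded_mul (c : T -> R) f K : measurable_fun setT c ->
  (\forall z \ae mu, `|c z| <= K) -> L2 f ->
  L2 (c \* f) /\ inner (c \* f) (c \* f) <= K ^+ 2 * inner f f.
Proof.
move=> mc cK f2; have mf := L2_measurable f2.
have mcf : measurable_fun setT (c \* f) by exact: measurable_funM.
have le : (\int[mu]_z ((c \* f) z ^+ 2)%:E <= (K ^+ 2 * inner f f)%:E)%E.
  rewrite EFinM -inner_EFin// -ge0_integralZl//; last 3 first.
  - by apply/measurable_EFinP; exact: measurable_funX.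
  - by move=> z _; rewrite lee_fin sqr_ge0.
  - by rewrite lee_fin sqr_ge0.
  apply: ae_ge0_le_integral => //.
  - by move=> z _; rewrite lee_fin sqr_ge0.
  - by apply/measurable_EFinP; exact: measurable_funX.
  - by move=> z _; rewrite -EFinM lee_fin mulr_ge0 ?sqr_ge0.
  - apply/measurable_EFinP; apply: measurable_funM => //; exact: measurable_funX.
  - apply: filterS cK => z cz _; rewrite -EFinM lee_fin exprMn.
    rewrite ler_wpM2r ?sqr_ge0// -[c z ^+ 2]real_normK ?num_real//.
    by rewrite lerXn2r ?nnegrE// (le_trans _ cz).
have cf2 : L2 (c \* f) by apply: L2P => //; apply: le_lt_trans le (ltry _).
by split=> //; rewrite -lee_fin -inner_EFin.
Qed.

End L2.

Section kernel_operator.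
Context d1 d2 (T1 : measurableType d1) (T2 : measurableType d2) (R : realType).
Variable m1 : {finite_measure set T1 -> \bar R}.
Variable m2 : {sigma_finite_measure set T2 -> \bar R}.
Variables (k : T1 * T1 -> R) (kappa : R).
Hypotheses (mk : measurable_fun setT k) (k_bnd : forall z, `|k z| <= kappa).
Hypothesis k_sym : forall x y, k (x, y) = k (y, x).
Local Notation mu := (m1 \x m2)%E.
Implicit Types u w : T1 * T2 -> R.

Definition kernel_op u : T1 * T2 -> R := fun z =>
  (\int[m1]_s (k (z.1, s) * u (s, z.2)))%R.

Lemma kappa_ge0 (x : T1) : 0 <= kappa.
Proof. exact: le_trans (normr_ge0 _) (k_bnd (x, x)). Qed.

Lemma ae_snd (Q : T2 -> Prop) : {ae m2, forall r, Q r} -> \forall z \ae mu, Q z.2.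
Proof.
move=> [Z [mZ Z0 QZ]]; exists (setT `*` Z); split=> [||z /= nQ].
- exact: measurableX.
- by rewrite /= product_measure1E// Z0 mule0.
- by split=> //; exact: QZ.
Qed.

(** [u] is only measurable, so the integral need not exist; it is [fine] of the difference of the
    integrals of the positive and negative parts, each measurable by Tonelli. *)
Lemma measurable_kernel_op u : measurable_fun setT u ->
  measurable_fun setT (kernel_op u).
Proof.
move=> mu'.
pose F (p : (T1 * T2) * T1) := (k (p.1.1, p.2) * u (p.2, p.1.2))%:E.
have mF : measurable_fun setT F.
  have h1 : measurable_fun setT (fun p : (T1 * T2) * T1 => (p.1.1, p.2)).
    apply: measurable_fun_pair => //.
    exact: measurableT_comp.
  have h2 : measurable_fun setT (fun p : (T1 * T2) * T1 => (p.2, p.1.2)).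
    apply: measurable_fun_pair => //.
    exact: measurableT_comp.
  apply/measurable_EFinP/measurable_funM; first exact: (measurableT_comp mk h1).
  exact: (measurableT_comp mu' h2).
rewrite (_ : kernel_op u = fine \o ((fun z => \int[m1]_s (F^\+ (z, s))%E)
    \- (fun z => \int[m1]_s (F^\- (z, s))%E))%E); last first.
  apply/funext => z; rewrite /kernel_op /Rintegral/=; congr fine.
  by rewrite [LHS]integralE; congr (_ - _)%E; apply: eq_integral => s _; rewrite unlock.
apply: (measurableT_comp (fine_measurable measurableT)) => //.
apply: emeasurable_funB.
- apply: (@measurable_fun_fubini_tonelli_F _ _ _ _ _ m1 F^\+%E) => //.
  exact: measurable_funepos.
- apply: (@measurable_fun_fubini_tonelli_F _ _ _ _ _ m1 F^\-%E) => //.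
  exact: measurable_funeneg.
Qed.

Lemma L2_section u : L2 mu u -> {ae m2, forall r, L2 m1 (fun s => u (s, r))}.
Proof.
move=> u2; have mu' := L2_measurable u2.
have iu : mu.-integrable setT (fun z => (u z ^+ 2)%:E).
  exact: Lfun2_integrable_sqr.
have := ae_integrable2 iu; apply: filterS => r /integrableP[_ ir].
apply: L2P; first exact: measurable_fun_pair1.
apply: le_lt_trans ir; rewrite le_eqVlt; apply/orP; left; apply/eqP.
by apply: eq_integral => z _ /=; rewrite ger0_norm ?sqr_ge0.
Qed.

Lemma L2_kernel x : L2 m1 (fun s => k (x, s)) /\
  inner m1 (fun s => k (x, s)) (fun s => k (x, s)) <= kappa ^+ 2 * fine (m1 setT).
Proof.
have mkx := measurable_fun_pair2 x mk.
have [|||k2 kB] := @L2_bounded_mul _ _ _ m1 (fun s => k (x, s)) (cst 1) kappa.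
- by [].
- by apply: nearW => s; exact: k_bnd.
- apply: L2P => //; rewrite (_ : (fun z => _) = cst 1%E).
    by rewrite integral_cst// mul1e -ge0_fin_numE// fin_num_measure.
  by apply/funext => z; rewrite expr1n.
have e : (fun s => k (x, s)) \* cst 1 = fun s => k (x, s).
  by apply/funext => s; rewrite /= mulr1.
rewrite e in k2 kB; split=> //; apply: le_trans kB _.
rewrite /inner (_ : (\int[m1]_z _)%R = fine (m1 setT))//.
under eq_Rintegral do rewrite /= mulr1.
by rewrite Rintegral_cst// mul1r.
Qed.

Lemma kernel_op_sqr_le u x r : L2 m1 (fun s => u (s, r)) ->
  kernel_op u (x, r) ^+ 2 <=
  kappa ^+ 2 * fine (m1 setT) * inner m1 (fun s => u (s, r)) (fun s => u (s, r)).
Proof.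
move=> ur; have [k2 kB] := L2_kernel x.
have h := cauchy_schwarz (L2_submodule m1) (inner_psd m1) k2 ur.
by apply: le_trans h _; rewrite ler_wpM2r// (inner_psd m1).2.
Qed.

(** Cauchy-Schwarz on almost every slice. One factor [M] comes from the norm of the bounded kernel,
    the other from integrating over the first variable. *)
Lemma L2_kernel_op : exists K, forall u, L2 mu u ->
  L2 mu (kernel_op u) /\ inner mu (kernel_op u) (kernel_op u) <= K * inner mu u u.
Proof.
set M := fine (m1 setT); exists (kappa ^+ 2 * M * M) => u u2.
have mu' := L2_measurable u2; have mK := measurable_kernel_op mu'.
have M0 : 0 <= M by rewrite fine_ge0.
have mEK : measurable_fun setT (fun z => (kernel_op u z ^+ 2)%:E).
  by apply/measurable_EFinP; exact: measurable_funX.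
have mEu : measurable_fun setT (fun z => (u z ^+ 2)%:E).
  by apply/measurable_EFinP; exact: measurable_funX.
have KM0 : 0 <= kappa ^+ 2 * M * M.
  by apply: mulr_ge0 => //; apply: mulr_ge0 => //; exact: sqr_ge0.
have le : (\int[mu]_z (kernel_op u z ^+ 2)%:E <=
           (kappa ^+ 2 * M * M * inner mu u u)%:E)%E.
  have ge0 v : forall z : T1 * T2, (0 <= (v z ^+ 2)%:E :> \bar R)%E.
    by move=> z; rewrite lee_fin sqr_ge0.
  rewrite EFinM -inner_EFin// !fubini_tonelli2//.
  rewrite /fubini_G -ge0_integralZl//; last 2 first.
  - by apply: (@measurable_fun_fubini_tonelli_G _ _ _ _ _ m1 (fun z => (u z ^+ 2)%:E)).
  - by move=> r _; apply: integral_ge0.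
  apply: ae_ge0_le_integral => //.
  - by move=> r _; apply: integral_ge0.
  - by apply: (@measurable_fun_fubini_tonelli_G _ _ _ _ _ m1 (fun z => (kernel_op u z ^+ 2)%:E)).
  - by move=> r _; rewrite mule_ge0// integral_ge0.
  - apply: emeasurable_funM => //.
    by apply: (@measurable_fun_fubini_tonelli_G _ _ _ _ _ m1 (fun z => (u z ^+ 2)%:E)).
  have := L2_section u2; apply: filterS => r ur _.
  rewrite (inner_EFin ur) -EFinM mulrAC.
  apply: le_trans (_ : (\int[m1]_x (kappa ^+ 2 * M *
     inner m1 (fun s => u (s, r)) (fun s => u (s, r)))%:E <= _)%E); last first.
    by rewrite integral_cst// [leRHS]EFinM {3}/M fineK ?fin_num_measure.
  apply: ge0_le_integral => //.
  - apply/measurable_EFinP/measurable_funX; exact: measurable_fun_pair1.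
  - by move=> x _; rewrite lee_fin; exact: kernel_op_sqr_le.
have K2 : L2 mu (kernel_op u) by apply: L2P => //; apply: le_lt_trans le (ltry _).
by split=> //; rewrite -lee_fin -inner_EFin.
Qed.

Lemma integrable_kernel x f : L2 m1 f ->
  m1.-integrable setT (fun s => (k (x, s) * f s)%:E).
Proof. by move=> f2; apply: L2_mul_integrable => //; case: (L2_kernel x). Qed.

(** [c z.2] leaves the integral on the slices where [u] is square-integrable, which are almost
    all. *)
Lemma kernel_op_mul_snd (c : T2 -> R) u : L2 mu u ->
  \forall z \ae mu, kernel_op ((c \o snd) \* u) z = c z.2 * kernel_op u z.
Proof.
move=> u2; have := ae_snd (L2_section u2).
apply: filterS => -[x r] /= ur.
rewrite /kernel_op -RintegralZl//=; last exact: integrable_kernel.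
by apply: eq_Rintegral => s _; ring.
Qed.

(** Fubini for k(x, y) f(y) g(x), which is integrable as [k] is bounded and L2 functions on a finite
    measure space are integrable. *)
Lemma kernel_swap f g : L2 m1 f -> L2 m1 g ->
  (\int[m1]_x ((\int[m1]_y (k (x, y) * f y)) * g x)%R%:E =
   \int[m1]_x (f x * \int[m1]_y (k (x, y) * g y))%R%:E)%E.
Proof.
move=> f2 g2.
have mf := L2_measurable f2; have mg := L2_measurable g2.
pose H (z : T1 * T1) := (k z * f z.2 * g z.1)%:E.
have mH : measurable_fun setT H.
  apply/measurable_EFinP; apply: measurable_funM; first apply: measurable_funM => //.
    exact: (measurableT_comp mf).
  exact: (measurableT_comp mg).
have L2_int h : L2 m1 h -> m1.-integrable setT (EFin \o h).
  move=> h2; apply/Lfun1_integrable; apply: Lfun_subset12 => //.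
  exact: fin_num_measure.
have iH : (m1 \x m1)%E.-integrable setT H.
  apply/integrable12ltyP => //.
  have /integrableP[_ fi] := L2_int _ f2; have /integrableP[_ gi] := L2_int _ g2.
  have mabs (h : T1 -> R) : measurable_fun setT h -> measurable_fun setT (fun x => `|(h x)%:E|%E).
    by move=> mh; apply: measurableT_comp => //; exact/measurable_EFinP.
  have [c c0 cE] : exists2 c : R, 0 <= c & (\int[m1]_y `|(f y)%:E|)%E = c%:E.
    have If0 : (0 <= \int[m1]_y `|(f y)%:E|)%E by apply: integral_ge0.
    exists (fine (\int[m1]_y `|(f y)%:E|)%E); first exact: fine_ge0.
    by rewrite fineK// ge0_fin_numE.
  (* That [kappa] is nonnegative is read off at a point of [T1]; over an empty [T1] the integrand is
     trivially 0. *)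
  have [[x0]|noT] := pselect (inhabited T1); last first.
    rewrite (_ : (fun x => _) = cst 0%E) ?integral0//.
    by apply/funext => x; exfalso; apply: noT; exists; exact: x.
  have kc0 : (0 <= (kappa * c)%:E)%E by rewrite lee_fin mulr_ge0// (kappa_ge0 x0).
  apply: le_lt_trans (_ : (\int[m1]_x ((kappa * c)%:E * `|(g x)%:E|) < +oo)%E); last first.
    rewrite ge0_integralZl//; last exact: mabs.
    by rewrite lte_mul_pinfty.
  apply: ge0_le_integral => //.
  - by move=> x _; apply: integral_ge0.
  - apply: (@measurable_fun_fubini_tonelli_F _ _ _ _ _ m1 (abse \o H)) => [|z].
      exact: measurableT_comp.
    exact: abse_ge0.
  - by apply: emeasurable_funM => //; exact: mabs.
  move=> x _; have kx := kappa_ge0 x.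
  have -> : ((kappa * c)%:E * `|(g x)%:E| =
      \int[m1]_y ((kappa * `|g x|)%:E * `|(f y)%:E|))%E.
    rewrite ge0_integralZl//; last 2 first.
    - exact: mabs.
    - by rewrite lee_fin mulr_ge0.
    by rewrite cE -!EFinM; congr EFin; ring.
  apply: ge0_le_integral => //.
  - apply: measurableT_comp => //; exact: measurable_fun_pair2.
  - by apply: emeasurable_funM => //; exact: mabs.
  move=> y _; rewrite /= lee_fin !normrM [leRHS]mulrAC.
  by rewrite ler_wpM2r// ler_wpM2r.
have := Fubini iH; rewrite /H /=.
move=> FH; transitivity (\int[m1]_x \int[m1]_y (k (x, y) * f y * g x)%:E)%E.
  apply: eq_integral => x _; have ix := integrable_kernel x f2.
  under [RHS]eq_integral do rewrite EFinM.
  rewrite integralZr// EFinM /Rintegral fineK//.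
  exact: integrable_fin_num.
rewrite FH; apply: eq_integral => y _; have iy := integrable_kernel y g2.
under eq_integral do rewrite k_sym mulrAC EFinM.
rewrite integralZr// muleC EFinM /Rintegral fineK//.
exact: integrable_fin_num.
Qed.

Lemma kernel_op_self_adjoint u w : L2 mu u -> L2 mu w ->
  inner mu (kernel_op u) w = inner mu u (kernel_op w).
Proof.
move=> u2 w2; have [K KB] := L2_kernel_op.
have [Ku2 _] := KB _ u2; have [Kw2 _] := KB _ w2.
have i1 := L2_mul_integrable Ku2 w2; have i2 := L2_mul_integrable u2 Kw2.
rewrite /inner /Rintegral -!integral21_prod_meas1//; congr fine.
apply: ae_eq_integral => //.
- exact: (measurable_fubini_G i1).
- exact: (measurable_fubini_G i2).
apply: filterS2 (L2_section u2) (L2_section w2) => r ur wr _.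
exact: (kernel_swap ur wr).
Qed.

End kernel_operator.

(** * Reflection invariance of the boundary measure *)

Section nonmeasurable_integral.
Local Open Scope ereal_scope.
Context d (T : measurableType d) (R : realType).
Variable mu : {measure set T -> \bar R}.
Implicit Types f g : T -> \bar R.

Import HBNNSimple.

(** The integral of a nonnegative function is the supremum over the simple functions below it.
    Cutting such a function off on [Z] keeps its integral and puts it below [g]. *)
Lemma ge0_le_integral_off_null f g (Z : set T) : measurable Z -> mu Z = 0 ->
  (forall x, 0 <= f x) -> (forall x, 0 <= g x) ->
  (forall x, ~ Z x -> f x <= g x) -> \int[mu]_x f x <= \int[mu]_x g x.
Proof.
move=> mZ Z0 f0 g0 fg; rewrite !ge0_integralTE//.
apply: ge_ereal_sup => _ [h hf <-]; apply: ereal_sup_ubound.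
have mZC : measurable (~` Z) by exact: measurableC.
exists (proj_nnsfun h mZC).
  move=> x /=; rewrite mindicE; have [/set_mem xZ|xZ] := boolP (x \in ~` Z).
    by rewrite mulr1 (le_trans (hf x))// fg.
  by rewrite mulr0.
rewrite -!integralT_nnsfun; apply: ae_eq_integral => //.
- by apply/measurable_EFinP; exact: measurable_funP.
- by apply/measurable_EFinP; exact: measurable_funP.
exists Z; split=> // x /= ne; apply: contrapT => nZ; apply: ne => _.
by rewrite /= mindicE mem_set// mulr1.
Qed.

(* No measurability is assumed: the integrand of Rop contains the outer normal, an
   arbitrary choice at the boundary points where it is not unique. *)
Lemma integral_off_null f g : f = g %[ae mu] -> \int[mu]_x f x = \int[mu]_x g x.
Proof.
move=> [Z [mZ Z0 fgZ]].
have fg x : ~ Z x -> f x = g x.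
  by move=> nZ; apply: contrapT => ne; apply: nZ; apply: fgZ => /= /(_ I).
rewrite integralE [RHS]integralE; congr (_ - _); apply/eqP; rewrite eq_le.
  by apply/andP; split; apply: (ge0_le_integral_off_null mZ Z0) => // x /fg h;
    rewrite unlock h.
by apply/andP; split; apply: (ge0_le_integral_off_null mZ Z0) => // x /fg h;
  rewrite unlock h.
Qed.

End nonmeasurable_integral.

Section invariant_measure.
Context d (T : measurableType d) (R : realType).
Variables (mu : {measure set T -> \bar R}) (rho : T -> T).
Hypothesis mrho : measurable_fun setT rho.
Hypothesis rho_inv : forall A, measurable A -> mu (rho @^-1` A) = mu A.

Lemma ge0_integral_invariant (f : T -> \bar R) : measurable_fun setT f ->
  (forall x, 0 <= f x)%E -> (\int[mu]_x f (rho x) = \int[mu]_x f x)%E.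
Proof.
move=> mf f0.
rewrite -[LHS](@ge0_integral_pushforward _ _ _ _ _ rho mrho mu setT f)//.
by apply: eq_measure_integral => // A mA _; exact: rho_inv.
Qed.

Lemma L2_invariant h : L2 mu h -> L2 mu (h \o rho).
Proof.
move=> h2; have mh := L2_measurable h2.
apply: L2P; first exact: measurableT_comp.
rewrite (@ge0_integral_invariant (fun z => (h z ^+ 2)%:E)); first exact: L2_sqr_lty.
- by apply/measurable_EFinP; exact: measurable_funX.
- by move=> x; rewrite lee_fin sqr_ge0.
Qed.

Lemma inner_invariant h g : L2 mu h -> L2 mu g ->
  inner mu (h \o rho) (g \o rho) = inner mu h g.
Proof.
move=> h2 g2; congr fine.
have i := L2_mul_integrable h2 g2.
have i' := L2_mul_integrable (L2_invariant h2) (L2_invariant g2).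
have := @integral_pushforward _ _ _ _ _ rho mrho mu setT
  (fun z => (h z * g z)%:E) (measurable_int _ i) i' measurableT.
rewrite preimage_setT => <-.
by apply: eq_measure_integral => // A mA _; exact: rho_inv.
Qed.

End invariant_measure.

Section reflection.
Variable R : realType.

Lemma measurable_oppr_rV n : measurable_fun setT (-%R : 'rV[R]_n -> 'rV[R]_n).
Proof.
apply/measurable_fun_rVP => i.
rewrite (_ : _ \o _ = fun x => - rV_coord i x); last first.
  by apply/funext => x; rewrite /= /rV_coord mxE.
by apply: measurableT_comp => //; exact: measurable_rV_coord.
Qed.

Lemma rV_consN n (x : R) (y : 'rV[R]_n) : rV_cons (- x, - y) = - rV_cons (x, y).
Proof.
apply/rowP => j; rewrite !mxE; case: (unlift ord0 j) => [k|] //=.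
by rewrite mxE.
Qed.

(** Induction by slicing: the section at x of the reflected set is the reflected section at -x,
    which leaves a reflection in dimension one. *)
Lemma lebesgue_rVN n (A : set 'rV[R]_n) : measurable A ->
  lebesgue_rV R n (-%R @^-1` A) = lebesgue_rV R n A.
Proof.
elim: n A => [|n IH] A mA.
  rewrite /= !diracE; congr ((_ : bool)%:R%:E).
  by apply/idP/idP => /set_mem h; apply/mem_set; move: h; rewrite /= oppr0.
set mu := lebesgue_rV R n in IH *.
pose B := @rV_cons R n @^-1` A.
have mB : measurable B.
  by rewrite -[X in measurable X]setTI; exact: measurable_rV_cons.
rewrite -[LHS]/(\int[@lebesgue_measure R]_x
  (mu \o xsection (@rV_cons R n @^-1` (-%R @^-1` A))) x)%E.
rewrite -[RHS]/(\int[@lebesgue_measure R]_x (mu \o xsection B) x)%E.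
have mphi : measurable_fun setT (mu \o xsection B).
  exact: measurable_fun_xsection.
transitivity (\int[@lebesgue_measure R]_x (mu \o xsection B) (- x)%R)%E.
  apply: eq_integral => x _ /=; rewrite -[RHS]IH; last exact: measurable_xsection.
  congr (mu _); apply/seteqP; split=> y /=; rewrite !xsectionE /B.
    by rewrite /= rV_consN.
  by rewrite /= rV_consN.
apply: (@ge0_integral_invariant _ (measurableTypeR R) R (@lebesgue_measure R) -%R) => //.
by move=> C mC; exact: lebesgue_measureN.
Qed.

(** [normalize] is odd and the punctured ball symmetric, so the cone over -A is the reflected cone
    over A. *)
Lemma sphere_measureN n (A : set 'rV[R]_n) : measurable A ->
  sphere_measure R n (-%R @^-1` A) = sphere_measure R n A.
Proof.
move=> mA; rewrite /sphere_measure; congr (_ * _)%E.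
rewrite -[RHS]lebesgue_rVN; last first.
  apply: measurableI; last exact: measurable_punctured_ball.
  by rewrite -[X in measurable X]setTI; exact: measurable_normalize.
have eN (x : 'rV[R]_n) : enorm (- x) = enorm x.
  by rewrite /enorm /dotr; congr Num.sqrt; apply: eq_bigr => i _; rewrite !mxE mulrNN.
have nN (x : 'rV[R]_n) : normalize (- x) = - normalize x.
  by rewrite /normalize eN scalerN.
congr (lebesgue_rV R n _); apply/seteqP; split=> x /=.
  by rewrite nN /punctured_ball/= eN.
by rewrite nN /punctured_ball/= eN.
Qed.

Variables (d : nat) (Om : bounded_convex_domain R d).

Definition reflection (z : bphase Om) : bphase Om := (- z.1, z.2).

Lemma measurable_reflection : measurable_fun setT reflection.
Proof.
apply: measurable_fun_pair => //.
by apply: measurableT_comp => //; exact: measurable_oppr_rV.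
Qed.

Lemma muB_reflection A : measurable A -> muB Om (reflection @^-1` A) = muB Om A.
Proof.
move=> mA.
change (\int[surface_measure Om]_y
    (sphere_measure R 3 (ysection (reflection @^-1` A) y)) =
  \int[surface_measure Om]_y (sphere_measure R 3 (ysection A y)))%E.
apply: eq_integral => y _.
rewrite -[RHS]sphere_measureN; last exact: measurable_ysection.
by congr (sphere_measure R 3 _); rewrite !ysectionE.
Qed.

Lemma proj_opp (s : 'rV[R]_3) : Defs.proj d (- s) = - Defs.proj d s.
Proof. by apply/rowP => i; rewrite !mxE. Qed.

Lemma sn_reflection z : sn (reflection z) = - sn z.
Proof.
rewrite /sn /reflection/= proj_opp /dotr -sumrN; apply: eq_bigr => i _.
by rewrite mxE mulNr.
Qed.

(** The weight goes into the function, so that the weighted inflow space is expressed by plain L2 of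
    [muB]. *)
Definition inflow_trace (t : bphase Om -> R) : bphase Om -> R :=
  fun z => \1_(@inflow R d Om) z * (Num.sqrt `|sn z| * t z).

Lemma inflow_trace_mul t t' z : inflow_trace t z * inflow_trace t' z =
  \1_(@inflow R d Om) z * (`|sn z| * t z * t' z).
Proof.
rewrite /inflow_trace -[X in _ = _ * (X * _ * _)]sqr_sqrtr// !indicE.
by case: (_ \in _); rewrite ?mul0r// !mul1r; ring.
Qed.

Lemma indic_inflow z : \1_(@inflow R d Om) z = (sn z < 0)%R%:R :> R.
Proof.
rewrite indicE; congr (_%:R); congr (nat_of_bool _).
by apply/idP/idP => [/set_mem//|h]; exact/mem_set.
Qed.

(** Reflection changes the sign of [sn], so for even traces the outflow half equals the inflow half,
    and points with [sn z = 0] carry no weight. This lets the inflow term of [Wnorm] control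
    [Rop]. *)
Lemma boundary_integral (t t' : bphase Om -> R) :
  L2_inflow Om t -> L2_inflow Om t' ->
  Defs.reflect t = t %[ae muB Om] -> Defs.reflect t' = t' %[ae muB Om] ->
  (\int[muB Om]_z (`|sn z| * t z * t' z))%R =
  2 * inner (muB Om) (inflow_trace t) (inflow_trace t').
Proof.
move=> t2 t2' et et'.
have mr := measurable_reflection; have ir := muB_reflection.
have h2 : L2 (muB Om) (inflow_trace t) by [].
have h2' : L2 (muB Om) (inflow_trace t') by [].
transitivity ((\int[muB Om]_z (inflow_trace t z * inflow_trace t' z +
   inflow_trace t (reflection z) * inflow_trace t' (reflection z)))%R).
  congr fine; apply: integral_off_null.
  apply: filterS2 et et' => z /= tz tz' _.
  have {}tz := tz I; have {}tz' := tz' I; rewrite /Defs.reflect in tz tz'.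
  congr EFin; rewrite !inflow_trace_mul !indic_inflow sn_reflection normrN.
  rewrite /reflection tz tz' oppr_lt0.
  have [_|_|->] := ltgtP (sn z) 0; rewrite /= ?normr0 ?mul1r ?mul0r ?addr0 ?add0r//.
rewrite RintegralD//; last 2 first.
- exact: L2_mul_integrable.
- exact: (L2_mul_integrable (L2_invariant mr ir h2) (L2_invariant mr ir h2')).
rewrite -[X in _ + X]/(inner _ (inflow_trace t \o reflection)
  (inflow_trace t' \o reflection)).
by rewrite (inner_invariant mr ir h2 h2') /inner; ring.
Qed.

Lemma inflow_integral (t t' : bphase Om -> R) :
  (\int[muB Om]_(z in @inflow R d Om) (`|sn z| * t z * t' z))%R =
  inner (muB Om) (inflow_trace t) (inflow_trace t').
Proof.
rewrite Rintegral_mkcond; apply: eq_Rintegral => z _.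
rewrite inflow_trace_mul patchE indicE.
by case: ifPn => zi; rewrite ?mul1r ?mul0r.
Qed.

End reflection.

(** * The scattering operators *)

Section L2_complements.
Context d (T : measurableType d) (R : realType).
Variable mu : {measure set T -> \bar R}.
Implicit Types f g : T -> R.

Lemma L2_ae_eq f f' : measurable_fun setT f -> f = f' %[ae mu] -> L2 mu f' ->
  L2 mu f /\ inner mu f f = inner mu f' f'.
Proof.
move=> mf ff' f2'.
have e : (\int[mu]_z (f z ^+ 2)%:E = \int[mu]_z (f' z ^+ 2)%:E)%E.
  by apply: integral_off_null; apply: filterS ff' => z /= h _; rewrite h.
have f2 : L2 mu f by apply: L2P => //; rewrite e; exact: L2_sqr_lty.
by split=> //; apply: EFin_inj; rewrite -!inner_EFin.
Qed.

Lemma inner_le f g x y : L2 mu f -> L2 mu g -> 0 <= x -> 0 <= y ->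
  inner mu f f <= x ^+ 2 -> inner mu g g <= y ^+ 2 -> `|inner mu f g| <= x * y.
Proof.
move=> f2 g2 x0 y0 fx gy.
rewrite -ler_sqr ?nnegrE ?mulr_ge0// real_normK ?num_real// exprMn.
apply: le_trans (cauchy_schwarz (L2_submodule mu) (inner_psd mu) f2 g2) _.
by rewrite ler_pM// (inner_psd mu).2.
Qed.

Lemma Linfty_bounded f : f \in Lfun mu +oo%E ->
  measurable_fun setT f /\ exists K, \forall z \ae mu, `|f z| <= K.
Proof.
rewrite inE => /andP[/[!inE]/= mf ff]; split=> //; move: ff.
rewrite /finite_norm unlock; case: ifPn => [mu0 /ess_supr_bounded//|].
(* The total measure is 0, so any bound holds almost everywhere. *)
rewrite -leNgt => mu0 _; exists 0, setT; split=> //.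
by apply/eqP; rewrite eq_le mu0/=.
Qed.

End L2_complements.

Section sphere.
Variables (R : realType) (n : nat).
Implicit Types x y : 'rV[R]_n.

Lemma dotrC x y : dotr x y = dotr y x.
Proof. by apply: eq_bigr => i _; rewrite mulrC. Qed.

Lemma dotr_psd : psd_form [set: 'rV[R]_n] (@dotr R n).
Proof.
split; first split=> [x y _ _|a x y z _ _ _]; last by move=> x _; exact: dotr_ge0.
  exact: dotrC.
rewrite /dotr mulr_sumr -big_split/=; apply: eq_bigr => i _.
by rewrite !mxE; ring.
Qed.

Lemma dotr_unit_le x y : enorm x = 1 -> enorm y = 1 -> `|dotr x y| <= 1.
Proof.
have sq z : enorm z = 1 -> dotr z z = 1.
  by move=> z1; rewrite -[LHS]sqr_sqrtr ?dotr_ge0// -/(enorm z) z1 expr1n.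
move=> /sq x1 /sq y1; rewrite -ler_sqr ?nnegrE// real_normK ?num_real// expr1n.
have mT : submodule [set: 'rV[R]_n] by [].
by have := @cauchy_schwarz _ _ _ mT _ x y dotr_psd I I; rewrite x1 y1 mulr1.
Qed.

Lemma sphere_measure_unit : \forall x \ae sphere_measure R n, enorm x = 1.
Proof.
exists [set x | enorm x != 1]; split.
- rewrite (_ : [set x | _] = ~` (@enorm R n @^-1` [set 1])).
    apply: measurableC; rewrite -[X in measurable X]setTI.
    exact: measurable_enorm.
  by apply/seteqP; split=> x /= /eqP.
- rewrite /= /sphere_measure (_ : _ `&` _ = set0) ?measure0 ?mule0//.
  apply/seteqP; split=> x //= [/eqP ne /andP[x0 _]]; apply: ne.
  rewrite /normalize /enorm /dotr.
  under eq_bigr do rewrite !mxE mulrACA -expr2.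
  rewrite -mulr_sumr sqrtrM ?sqr_ge0// sqrtr_sqr gtr0_norm ?invr_gt0//.
  by rewrite mulVf// gt_eqF.
- by move=> x /= /eqP.
Qed.

Lemma measurable_dotr :
  measurable_fun setT (fun p : 'rV[R]_n * 'rV[R]_n => dotr p.1 p.2).
Proof.
apply: measurable_sum => i; apply: measurable_funM.
- exact: (measurableT_comp (measurable_rV_coord i)).
- exact: (measurableT_comp (measurable_rV_coord i)).
Qed.

End sphere.

Section scattering.
Variables (R : realType) (d : nat) (Om : bounded_convex_domain R d).
Variables (g : R) (sigma_a sigma_s : 'rV[R]_d -> R).
Hypothesis hg : 0 <= g < 1.

Lemma measurable_hg_kernel : measurable_fun setT (hg_kernel g).
Proof.
rewrite /hg_kernel; apply: measurable_funM => //; apply: measurable_funM => //.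
rewrite (_ : (fun x => _) =
    (fun y => y `^ (- (3 / 2))) \o (fun c => 1 - 2 * g * c + g ^+ 2)); last first.
  by apply/funext => c /=; rewrite powRN.
apply: (measurableT_comp (measurable_powR _)).
apply: measurable_funD => //; apply: measurable_funB => //.
Qed.

(** The value of the kernel at c = 1, where its denominator is least because g >= 0. *)
Let kappa : R := (4 * pi)^-1 * ((1 - g ^+ 2) / ((1 - g) ^+ 2) `^ (3 / 2)).

(** Directions are vectors of the ambient space, and off the sphere the kernel may be unbounded; the
    cut leaves it unchanged on unit vectors. *)
Let unit_kernel (p : 'rV[R]_3 * 'rV[R]_3) : R :=
  if `|dotr p.1 p.2| <= 1 then hg_kernel g (dotr p.1 p.2) else 0.

Lemma hg_kernel_bounded c : `|c| <= 1 -> `|hg_kernel g c| <= kappa.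
Proof.
rewrite ler_norml => /andP[c1 c2]; case/andP: hg => g0 g1.
have g2 : 0 <= 1 - g ^+ 2 by nra.
have h1 : 0 < (1 - g) ^+ 2 by rewrite exprn_gt0// subr_gt0.
have h2 : (1 - g) ^+ 2 <= 1 - 2 * g * c + g ^+ 2 by nra.
have h3 : 0 < 1 - 2 * g * c + g ^+ 2 by exact: lt_le_trans h2.
have p0 : 0 <= (4 * pi)^-1 :> R by rewrite invr_ge0 mulr_ge0// pi_ge0.
rewrite /hg_kernel /kappa ger0_norm; last by rewrite mulr_ge0// divr_ge0// powR_ge0.
rewrite ler_wpM2l// ler_wpM2l// lef_pV2 ?posrE ?powR_gt0//.
by rewrite ge0_ler_powR// ?nnegrE ?ltW// divr_ge0.
Qed.

Lemma unit_kernel_bounded p : `|unit_kernel p| <= kappa.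
Proof.
rewrite /unit_kernel; case: ifPn => [|_]; first exact: hg_kernel_bounded.
have : `|0 : R| <= 1 by rewrite normr0.
by move=> /hg_kernel_bounded; rewrite normr0; exact: le_trans.
Qed.

Lemma measurable_unit_kernel : measurable_fun setT unit_kernel.
Proof.
have md := @measurable_dotr R 3.
apply: measurable_fun_ifT => //.
- by apply: measurable_fun_ler => //; exact: measurableT_comp.
- exact: (measurableT_comp measurable_hg_kernel).
Qed.

Lemma unit_kernel_sym x y : unit_kernel (x, y) = unit_kernel (y, x).
Proof. by rewrite /unit_kernel /= dotrC. Qed.

Let mk := measurable_unit_kernel.
Let kB := unit_kernel_bounded.
Let kS := unit_kernel_sym.
Let T := @kernel_op _ _ _ ('rV[R]_d) R (sphere_measure R 3) unit_kernel.

Lemma muD_unit : \forall z \ae muD Om, enorm z.1 = 1.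
Proof.
have [Z [mZ Z0 hZ]] := sphere_measure_unit R 3.
exists (Z `*` setT); split=> [||z /= nz].
- exact: measurableX.
- have -> : muD Om (Z `*` setT) = (sphere_measure R 3 Z * dom_measure Om setT)%E.
    exact: product_measure1E.
  by rewrite [X in (X * _)%E]Z0 mul0e.
- by split=> //; exact: hZ.
Qed.

Lemma Sop_unit_kernel u : Sop g u = T u %[ae muD Om].
Proof.
apply: filterS muD_unit => z z1 _; congr fine; apply: integral_off_null.
apply: filterS (sphere_measure_unit R 3) => s s1 _.
by rewrite /unit_kernel/= dotr_unit_le.
Qed.

Local Notation DL2 := (L2 (muD Om)).
Local Notation ipD := (inner (muD Om)).

(** Almost everywhere equality with [T u] does not yield measurability, which is obtained from the
    uncut kernel instead. *)
Lemma measurable_Sop (u : phase R d -> R) : DL2 u ->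
  measurable_fun [set: ('rV[R]_3 * 'rV[R]_d)%type] (Sop g u).
Proof.
move=> /L2_measurable mu.
have mh := measurableT_comp measurable_hg_kernel (@measurable_dotr R 3).
exact: (measurable_kernel_op (sphere_measure R 3) mh mu).
Qed.

Lemma muD_mul_snd (c : 'rV[R]_d -> R) : c \in Lfun (dom_measure Om) +oo%E ->
  exists2 K, 0 <= K & forall u : phase R d -> R, DL2 u ->
    DL2 ((c \o snd) \* u) /\ ipD ((c \o snd) \* u) ((c \o snd) \* u) <= K ^+ 2 * ipD u u.
Proof.
move=> /Linfty_bounded[mc [K cK]]; exists `|K| => // u u2.
apply: L2_bounded_mul => //; first exact: (measurableT_comp mc).
have := @ae_snd _ _ _ _ R (sphere_measure R 3) (dom_measure Om) _ cK.
by apply: filterS => z /le_trans; apply; exact: ler_norm.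
Qed.

Hypothesis sa_bnd : sigma_a \in Lfun (dom_measure Om) +oo%E.
Hypothesis ss_bnd : sigma_s \in Lfun (dom_measure Om) +oo%E.

Let K' (u : phase R d -> R) : phase R d -> R := (sigma_s \o snd) \* T u.

Lemma Kop_unit_kernel u : Kop g sigma_s u = K' u %[ae muD Om].
Proof. by apply: filterS (Sop_unit_kernel u) => z /= h _; rewrite /Kop h. Qed.

Lemma T_bounded : exists2 K, 0 <= K & forall u, DL2 u ->
  DL2 (T u) /\ ipD (T u) (T u) <= K ^+ 2 * ipD u u.
Proof.
have [K KB] := @L2_kernel_op _ _ _ _ R (sphere_measure R 3) (dom_measure Om)
  unit_kernel kappa mk kB.
exists (`|K| + 1); first by rewrite addr_ge0.
move=> u u2; have [Tu2 Tu] := KB u u2; split=> //; apply: le_trans Tu _.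
rewrite ler_wpM2r ?(inner_psd (muD Om)).2//.
by have := ler_norm K; have : 0 <= `|K| by []; nra.
Qed.

Lemma Kop_bounded : exists2 K, 0 <= K & forall u, DL2 u ->
  DL2 (Kop g sigma_s u) /\
  ipD (Kop g sigma_s u) (Kop g sigma_s u) <= K ^+ 2 * ipD u u.
Proof.
have [K1 K10 sB] := muD_mul_snd ss_bnd; have [K2 K20 TB] := T_bounded.
exists (K1 * K2) => [|u u2]; first exact: mulr_ge0.
have [Tu2 Tu] := TB _ u2; have [Ku2 Ku] := sB _ Tu2.
have [mss _] := Linfty_bounded ss_bnd.
have mK : measurable_fun [set: ('rV[R]_3 * 'rV[R]_d)%type] (Kop g sigma_s u).
  apply: measurable_funM; last exact: measurable_Sop.
  exact: (measurableT_comp mss).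
have [L2K ->] := L2_ae_eq mK (Kop_unit_kernel u) Ku2.
split=> //; apply: le_trans Ku _.
by rewrite exprMn -[leRHS]mulrA; exact: (ler_wpM2l (sqr_ge0 K1) Tu).
Qed.

(** [T] acts on the direction only, so it commutes almost everywhere with multiplication by
    [sigma_s]. *)
Lemma Kop_self_adjoint : self_adjoint DL2 ipD (Kop g sigma_s).
Proof.
have [K1 _ sB] := muD_mul_snd ss_bnd; have [K2 _ TB] := T_bounded.
have [K3 _ KB] := Kop_bounded.
split=> [u /KB[]//|u w u2 w2].
have [Tu2 _] := TB _ u2; have [Tw2 _] := TB _ w2.
have [K'u _] := sB _ Tu2; have [K'w _] := sB _ Tw2; have [sw _] := sB _ w2.
have [Ku _] := KB _ u2; have [Kw _] := KB _ w2; have [Tsw _] := TB _ sw.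
rewrite (inner_ae_eq Ku K'u w2 (Kop_unit_kernel u)).
rewrite [RHS](sformC (inner_psd (muD Om)).1)//.
rewrite (inner_ae_eq Kw K'w u2 (Kop_unit_kernel w)).
transitivity (ipD (T u) ((sigma_s \o snd) \* w)).
  by apply: eq_Rintegral => z _; rewrite /K'/=; ring.
rewrite (kernel_op_self_adjoint (m2 := dom_measure Om) mk kB kS)//.
have bS := (inner_psd (muD Om)).1.
rewrite -[LHS]/(ipD u (T ((sigma_s \o snd) \* w))).
rewrite [LHS](sformC bS)//; apply: inner_ae_eq => //.
have := kernel_op_mul_snd mk kB sigma_s (m2 := dom_measure Om) w2.
by apply: filterS => z h _; exact: h.
Qed.

Let sigma_t : 'rV[R]_d -> R := sigma_a \+ sigma_s.

Lemma sigma_t_bounded : sigma_t \in Lfun (dom_measure Om) +oo%E.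
Proof. exact: (Lfun_addr_closed _ (leey 1%:E)).2. Qed.

Lemma Mop_bounded : exists2 K, 0 <= K & forall u, DL2 u ->
  DL2 (Mop sigma_a sigma_s u) /\
  ipD (Mop sigma_a sigma_s u) (Mop sigma_a sigma_s u) <= K ^+ 2 * ipD u u.
Proof. exact: muD_mul_snd sigma_t_bounded. Qed.

Lemma Mop_self_adjoint : self_adjoint DL2 ipD (Mop sigma_a sigma_s).
Proof.
have [K _ MB] := Mop_bounded; split=> [u /MB[]//|u w _ _].
by apply: eq_Rintegral => z _; rewrite /Mop; ring.
Qed.

Lemma MK_self_adjoint : self_adjoint DL2 ipD (MK g sigma_a sigma_s).
Proof.
have mT := L2_submodule (muD Om).
have [[DM MA] [DK KA]] := (Mop_self_adjoint, Kop_self_adjoint).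
have bS := (inner_psd (muD Om)).1.
split=> [u u2|u w u2 w2].
  by apply: (submoduleB mT); [exact: DM|exact: DK].
have [[[Mu Ku] Mw] Kw] := (DM _ u2, DK _ u2, DM _ w2, DK _ w2).
rewrite -[LHS]/(ipD (Mop sigma_a sigma_s u - Kop g sigma_s u) w).
rewrite -[RHS]/(ipD u (Mop sigma_a sigma_s w - Kop g sigma_s w)).
by rewrite (sformBl bS)// (sformBr mT bS)// MA// KA.
Qed.

Hypothesis MK_inv : MK_invertible Om g sigma_a sigma_s.

Local Notation MKinv := (MKinv Om g sigma_a sigma_s).

Lemma Vodd_submodule : submodule (Vodd Om).
Proof.
have [h0 hL] := L2_submodule (muD Om).
split; first by split=> //; apply: nearW => z _ /=; rewrite oppr0.
move=> a v w [v2 vo] [w2 wo]; split; first exact: hL.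
apply: filterS2 vo wo => z /(_ I) hv /(_ I) hw _.
rewrite -[LHS]/(a * Defs.reflect v z + Defs.reflect w z) hv hw.
by rewrite -[RHS]/(- (a * v z + w z)) /=; ring.
Qed.

Lemma MKinv_spec v : Vodd Om v ->
  Vodd Om (MKinv v) /\ MK g sigma_a sigma_s (MKinv v) = v %[ae muD Om].
Proof.
move=> vo; have [C /(_ _ vo)[u [uo uv _ _]]] := MK_inv.
exact: (@xgetPex _ (cst 0) [set u | Vodd Om u /\ MK g sigma_a sigma_s u = v %[ae muD Om]]
  (ex_intro _ u (conj uo uv))).
Qed.

(** [MKinv] picks some solution; the uniqueness clause identifies it almost everywhere with the
    bounded one. *)
Lemma MKinv_bounded : exists2 C, 0 <= C & forall v, Vodd Om v ->
  ipD (MKinv v) (MKinv v) <= C ^+ 2 * ipD v v.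
Proof.
have [C CB] := MK_inv; exists (`|C| + 1); first by rewrite addr_ge0.
move=> v vo; have [u [[u2 uo] uv ule uniq]] := CB _ vo.
have [[v2 v'o] v'v] := MKinv_spec vo.
have e := uniq _ (conj v2 v'o) v'v.
rewrite (inner_ae_eq v2 u2 v2 e) (sformC (inner_psd (muD Om)).1)//.
rewrite (inner_ae_eq v2 u2 u2 e); apply: le_trans ule _.
rewrite ler_wpM2r ?(inner_psd (muD Om)).2//; first by case: vo.
by have := ler_norm C; have : 0 <= `|C| by []; nra.
Qed.

Lemma MKinv_self_adjoint : self_adjoint (Vodd Om) ipD MKinv.
Proof.
split=> [v /MKinv_spec[]//|v w vo wo].
have [[v2' _] vE] := MKinv_spec vo; have [[w2' _] wE] := MKinv_spec wo.
have [v2 _] := vo; have [w2 _] := wo.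
have bS := (inner_psd (muD Om)).1.
have [DMK MKA] := MK_self_adjoint.
rewrite (sformC bS)// -(inner_ae_eq (DMK _ w2') w2 v2' wE).
by rewrite -(inner_ae_eq (DMK _ v2') v2 w2' vE) [LHS](sformC bS) ?MKA//; exact: DMK.
Qed.

End scattering.

(** * The energy form *)

Section transport_form.
Variables (R : realType) (d : nat) (Om : bounded_convex_domain R d).
Variables (g : R) (sigma_a sigma_s : 'rV[R]_d -> R).
Hypothesis hg : 0 <= g < 1.
Hypothesis sa_bnd : sigma_a \in Lfun (dom_measure Om) +oo%E.
Hypothesis ss_bnd : sigma_s \in Lfun (dom_measure Om) +oo%E.
Hypothesis MK_inv : MK_invertible Om g sigma_a sigma_s.

Local Notation ipD := (inner (muD Om)).
Local Notation ipB := (inner (muB Om)).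
Local Notation MKinv := (MKinv Om g sigma_a sigma_s).
Local Notation Mop := (Mop sigma_a sigma_s).
Local Notation Kop := (Kop g sigma_s).
Local Notation EK := (EK Om g sigma_a sigma_s).
Local Notation inflow_of w := (inflow_trace (trace_of w)).
Implicit Types u v w : triple Om.

(* Green's formula plays no role for the energy form, so it is left out of the
   space on which the form is studied. *)
Definition transport_space : set (triple Om) :=
  [set w | [/\ L2D Om (val_of w), Vodd Om (grad_of w), L2_inflow Om (trace_of w) &
     Defs.reflect (trace_of w) = trace_of w %[ae muB Om]]].

Definition graph_form u v : R :=
  ipD (grad_of u) (grad_of v) + ipD (val_of u) (val_of v)
  + ipB (inflow_of u) (inflow_of v).

Local Notation Y := transport_space.
Let DS := (inner_psd (muD Om)).1.
Let BS := (inner_psd (muB Om)).1.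
Let DM := L2_submodule (muD Om).
Let BM := L2_submodule (muB Om).

Lemma Wplus_transport : Wplus Om `<=` Y.
Proof. by move=> w [[w2 g2 _ t2] _ go to]; split. Qed.

Lemma inflow_trace_linear (a : R) (t t' : bphase Om -> R) :
  inflow_trace (a *: t + t') = a *: inflow_trace t + inflow_trace t'.
Proof.
apply/funext => z; rewrite -[RHS]/(a * inflow_trace t z + inflow_trace t' z).
by rewrite /inflow_trace -[X in _ * (_ * X)]/(a * t z + t' z); ring.
Qed.

Lemma transport_submodule : submodule Y.
Proof.
have [D0 DL] := DM; have [B0 BL] := BM; have [V0 VL] := Vodd_submodule Om.
split; first split=> //.
- rewrite /L2_inflow/= (_ : (fun z => _) = 0)//.
  by apply/funext => z; rewrite !mulr0.
- exact: nearW.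
move=> a u v [u2 uo ut ur] [v2 vo vt vr]; split.
- by rewrite -[val_of _]/(a *: val_of u + val_of v); exact: DL a _ _ u2 v2.
- by rewrite -[grad_of _]/(a *: grad_of u + grad_of v); exact: VL a _ _ uo vo.
- rewrite -[L2_inflow _ _]/(L2 (muB Om) (inflow_trace (a *: trace_of u + trace_of v))).
  by rewrite inflow_trace_linear; exact: BL a _ _ ut vt.
- apply: filterS2 ur vr => z /(_ I) hu /(_ I) hv _.
  rewrite -[LHS]/(a * Defs.reflect (trace_of u) z + Defs.reflect (trace_of v) z).
  by rewrite hu hv.
Qed.

Lemma graph_form_psd : psd_form Y graph_form.
Proof.
split; first split.
- move=> u v [u2 [gu _] ut _] [v2 [gv _] vt _].
  by rewrite /graph_form (sformC DS gu gv) (sformC DS u2 v2) (sformC BS ut vt).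
- move=> a u v w [u2 [gu _] ut _] [v2 [gv _] vt _] [w2 [gw _] wt _].
  have e : inflow_of (a *: u + v) = a *: inflow_of u + inflow_of v.
    exact: inflow_trace_linear.
  rewrite /graph_form e (BS.2 a _ _ _ ut vt wt).
  rewrite -[grad_of (a *: u + v)]/(a *: grad_of u + grad_of v) (DS.2 a _ _ _ gu gv gw).
  rewrite -[val_of (a *: u + v)]/(a *: val_of u + val_of v) (DS.2 a _ _ _ u2 v2 w2).
  by ring.
- move=> u [u2 [gu _] ut _]; rewrite /graph_form.
  by rewrite !addr_ge0// ?(inner_psd (muD Om)).2// (inner_psd (muB Om)).2.
Qed.

Lemma Wnorm_sqr w : Y w -> Wnorm Om w ^+ 2 = graph_form w w.
Proof.
move=> Yw; rewrite -[RHS]sqr_sqrtr ?graph_form_psd.2//.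
congr (Num.sqrt (_ + _) ^+ 2).
rewrite -inflow_integral; apply: eq_Rintegral => z _.
by rewrite expr2 mulrA.
Qed.

Lemma graph_form_bounds w : Y w -> [/\ ipD (grad_of w) (grad_of w) <= Wnorm Om w ^+ 2,
  ipD (val_of w) (val_of w) <= Wnorm Om w ^+ 2 &
  ipB (inflow_of w) (inflow_of w) <= Wnorm Om w ^+ 2].
Proof.
move=> Yw; rewrite Wnorm_sqr// /graph_form; have [w2 [gw _] wt _] := Yw.
have h1 := (inner_psd (muD Om)).2 _ w2; have h2 := (inner_psd (muD Om)).2 _ gw.
have h3 := (inner_psd (muB Om)).2 _ wt.
by split; lra.
Qed.

Lemma EKE u w : Y u -> Y w ->
  EK u w = 2 * ipB (inflow_of u) (inflow_of w) + ipD (grad_of w) (MKinv (grad_of u))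
    + ipD (Mop (val_of u)) (val_of w) - ipD (Kop (val_of u)) (val_of w).
Proof.
move=> [_ _ ut ur] [_ _ wt wr].
by rewrite /Defs.EK /Eop /Rop boundary_integral.
Qed.

Lemma EK_sym_form : sym_form Y EK.
Proof.
have [DI IA] := MKinv_self_adjoint hg sa_bnd ss_bnd MK_inv.
have [DMo MA] := Mop_self_adjoint sa_bnd ss_bnd.
have [DK KA] := Kop_self_adjoint hg ss_bnd.
have sym u w : Y u -> Y w -> EK u w = EK w u.
  move=> Yu Yw; rewrite !EKE//.
  have [u2 uo ut _] := Yu; have [w2 wo wt _] := Yw.
  have [gu _] := uo; have [gw _] := wo.
  rewrite (sformC BS ut wt) -(IA _ _ wo uo).
  rewrite (sformC DS (DI _ wo).1 gu) (MA _ _ u2 w2) (KA _ _ u2 w2).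
  by rewrite (sformC DS u2 (DMo _ w2)) (sformC DS u2 (DK _ w2)).
split=> // a u v w Yu Yv Yw; have Yauv := transport_submodule.2 a _ _ Yu Yv.
(* [MKinv] is a choice, linear only almost everywhere. Symmetry moves the combination to the second
   argument, where only [MKinv (grad_of w)] occurs. *)
rewrite (sym _ _ Yauv Yw) (sym _ _ Yu Yw) (sym _ _ Yv Yw) !EKE//.
have [u2 uo ut _] := Yu; have [v2 vo vt _] := Yv; have [w2 wo wt _] := Yw.
have [gu _] := uo; have [gv _] := vo; have [gw _] := wo.
have lin (f f1 f2 : phase R d -> R) : L2D Om f -> L2D Om f1 -> L2D Om f2 ->
    ipD f (a *: f1 + f2) = a * ipD f f1 + ipD f f2.
  move=> h h1 h2; rewrite (sformC DS h (DM.2 a _ _ h1 h2)) (DS.2 a _ _ _ h1 h2 h).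
  by rewrite (sformC DS h1 h) (sformC DS h2 h).
have e : inflow_of (a *: u + v) = a *: inflow_of u + inflow_of v.
  exact: inflow_trace_linear.
rewrite e (sformC BS wt (BM.2 a _ _ ut vt)) (BS.2 a _ _ _ ut vt wt).
rewrite (sformC BS ut wt) (sformC BS vt wt).
rewrite -[grad_of (a *: u + v)]/(a *: grad_of u + grad_of v).
rewrite -[val_of (a *: u + v)]/(a *: val_of u + val_of v).
rewrite (DS.2 a _ _ _ gu gv (DI _ wo).1).
rewrite (lin _ _ _ (DMo _ w2) u2 v2) (lin _ _ _ (DK _ w2) u2 v2).
by ring.
Qed.

Lemma EK_bounded : exists2 C, 0 <= C & forall u w, Y u -> Y w ->
  `|EK u w| <= C * (Wnorm Om u * Wnorm Om w).
Proof.
have [CI CI0 IB] := MKinv_bounded MK_inv.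
have [CM CM0 MB] := Mop_bounded sa_bnd ss_bnd.
have [CK CK0 KB] := Kop_bounded hg ss_bnd.
have [DI _] := MKinv_self_adjoint hg sa_bnd ss_bnd MK_inv.
exists (2 + CI + CM + CK) => [|u w Yu Yw]; first by rewrite !addr_ge0.
rewrite EKE//; have [ug uv ut] := graph_form_bounds Yu.
have [wg wv wt] := graph_form_bounds Yw.
have [u2 uo ut2 _] := Yu; have [w2 wo wt2 _] := Yw.
have [gw _] := wo.
have [Mu2 Mu] := MB _ u2; have [Ku2 Ku] := KB _ u2.
have Iu2 := (DI _ uo).1; have Iu := IB _ uo.
have Nu : 0 <= Wnorm Om u by exact: sqrtr_ge0.
have Nw : 0 <= Wnorm Om w by exact: sqrtr_ge0.
have grow (C x y : R) : x <= C ^+ 2 * y -> y <= Wnorm Om u ^+ 2 ->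
    x <= (C * Wnorm Om u) ^+ 2.
  move=> xy yN; apply: le_trans xy _; rewrite exprMn.
  by rewrite ler_wpM2l// sqr_ge0.
have hT := inner_le ut2 wt2 Nu Nw ut wt.
have hI := inner_le gw Iu2 Nw (mulr_ge0 CI0 Nu) wg (grow _ _ _ Iu ug).
have hM := inner_le Mu2 w2 (mulr_ge0 CM0 Nu) Nw (grow _ _ _ Mu uv) wv.
have hK := inner_le Ku2 w2 (mulr_ge0 CK0 Nu) Nw (grow _ _ _ Ku uv) wv.
move: hT hI hM hK; rewrite !ler_norml.
move=> /andP[? ?] /andP[? ?] /andP[? ?] /andP[? ?]; apply/andP; split; lra.
Qed.

Lemma ell_linear (q : phase R d -> R) (f : bphase Om -> R) :
  L2D Om q -> L2_inflow Om f ->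
  forall (a : R) u v, Y u -> Y v ->
  ell Om g sigma_a sigma_s q f (a *: u + v) =
  a * ell Om g sigma_a sigma_s q f u + ell Om g sigma_a sigma_s q f v.
Proof.
move=> q2 f2 a u v [u2 [gu _] ut _] [v2 [gv _] vt _].
(* [MKinv] returns either a solution in L2 or its default 0. *)
have I2 : L2D Om (MKinv (odd_part q)).
  rewrite /Defs.MKinv; case: xgetP => [w _ [[]//]|_]; exact: DM.1.
rewrite /ell !inflow_integral.
have lin (h w1 w2 : phase R d -> R) : L2D Om h -> L2D Om w1 -> L2D Om w2 ->
    ip Om h (a *: w1 + w2) = a * ip Om h w1 + ip Om h w2.
  move=> hh h1 h2; rewrite -[LHS]/(ipD h (a *: w1 + w2)).
  rewrite (sformC DS hh (DM.2 a _ _ h1 h2)) (DS.2 a _ _ _ h1 h2 hh).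
  by rewrite (sformC DS h1 hh) (sformC DS h2 hh).
have e : inflow_of (a *: u + v) = a *: inflow_of u + inflow_of v.
  exact: inflow_trace_linear.
rewrite e (sformC BS f2 (BM.2 a _ _ ut vt)) (BS.2 a _ _ _ ut vt f2).
rewrite (sformC BS ut f2) (sformC BS vt f2).
rewrite -[val_of (a *: u + v)]/(a *: val_of u + val_of v).
rewrite -[Aop (a *: u + v)]/(a *: Aop u + Aop v).
by rewrite (lin _ _ _ q2 u2 v2) (lin _ _ _ I2 gu gv); ring.
Qed.

End transport_form.

Theorem lemma3p2 (R : realType) (d : nat) (hd : (1 <= d <= 3)%N)
  (Om : bounded_convex_domain R d)
  (g gamma : R) (hg : 0 <= g < 1) (hgamma : 0 < gamma)
  (sigma_a sigma_s : 'rV[R]_d -> R)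
  (sa_bnd : sigma_a \in Lfun (dom_measure Om) +oo%E)
  (ss_bnd : sigma_s \in Lfun (dom_measure Om) +oo%E)
  (sa_gamma : {ae dom_measure Om, forall r, gamma <= sigma_a r})
  (ss_ge0 : {ae dom_measure Om, forall r, 0 <= sigma_s r})
  (MK_inv : MK_invertible Om g sigma_a sigma_s)
  (q : phase R d -> R) (hq : L2D Om q)
  (f : bphase Om -> R) (hf : L2_inflow Om f)
  (P1 : (triple Om -> R) -> triple Om)
  (P1_op : dual_operator (Wplus Om) (Wnorm Om) P1)
  (P1_sym : symmetric_on_dual (Wplus Om) (Wnorm Om) P1)
  (P1_pos : positive_definite (Wplus Om) (Wnorm Om) P1)
  (WN : set (triple Om))
  (WN_closed : closed_subspace (Wplus Om) (Wnorm Om) WN)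
  (beta : R) (hbeta : 0 < beta <= 1)
  (heig : forall lambda : R,
     pencil_spectrum (Wplus Om) (Wnorm Om) P1
       (EK Om g sigma_a sigma_s) lambda -> beta <= lambda <= 1)
  (u : triple Om) (hu : Wplus Om u)
  (hu_sol : forall v, Wplus Om v ->
     EK Om g sigma_a sigma_s u v = ell Om g sigma_a sigma_s q f v)
  (u_ uhalf_ uc_ : nat -> triple Om)
  (hu_ : forall n, Wplus Om (u_ n)) (huhalf_ : forall n, Wplus Om (uhalf_ n))
  (half_step : forall n, eq_in (Wnorm Om) (uhalf_ n)
     (u_ n - P1 (EK Om g sigma_a sigma_s (u_ n) - ell Om g sigma_a sigma_s q f)))
  (huc_ : forall n, WN (uc_ n))
  (correction : forall n v, WN v ->
     EK Om g sigma_a sigma_s (uc_ n) v =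
     (EK Om g sigma_a sigma_s
        (P1 (EK Om g sigma_a sigma_s (u_ n) - ell Om g sigma_a sigma_s q f))
      - (EK Om g sigma_a sigma_s (u_ n) - ell Om g sigma_a sigma_s q f)) v)
  (full_step : forall n, eq_in (Wnorm Om) (u_ n.+1) (uhalf_ n + uc_ n)) :
  forall n, energy_norm Om g sigma_a sigma_s (u - u_ n.+1)
            <= (1 - beta) * energy_norm Om g sigma_a sigma_s (u - u_ n).

Proof.
have [WNX WN0 _ _] := WN_closed.
have [C C0 EKB] := EK_bounded hg sa_bnd ss_bnd MK_inv.
move=> n; rewrite /energy_norm.
apply: (@two_level_contraction _ _ (Wplus Om) (@transport_space R d Om) (Wnorm Om)
  (@graph_form R d Om) (EK Om g sigma_a sigma_s) C P1 _ _ _ _ _ _ _ C0 EKB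
  P1_op P1_sym P1_pos beta hbeta heig WN (ell Om g sigma_a sigma_s q f)
  u (u_ n) (uhalf_ n) (uc_ n) (u_ n.+1)) => //.
- exact: Wplus_transport.
- exact: WNX.
- exact: transport_submodule.
- exact: graph_form_psd.
- by move=> v; exact: sqrtr_ge0.
- exact: Wnorm_sqr.
- exact: EK_sym_form.
- exact: ell_linear.
- exact: half_step.
- exact: correction.
- exact: full_step.
Qed.
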